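(* Let $n\ge4$, $I=[n]$ and let $W$ be the Weyl group of type $D_n$. Let $i\in I$, $w\in W^{I\setminus\{i\}}$, and $\gamma\in\Delta^+\setminus\Delta^+_{I\setminus\{i\}}$. There exists a quantum edge $w\xrightarrow{\gamma}\lfloor wr_\gamma\rfloor$ in the quantum Bruhat graph $\mathrm{QB}^{I\setminus\{i\}}$ if and only if one of the following statements holds. (q-D1) $i\in[n-2]$, $c_i(\gamma^\vee)=1$, and, writing $\{a_1<a_2<\cdots<a_{n-i+1}\}=[n]\setminus\{\|w(u)\|\mid u\in[i-1]\}$: $a_1=1$, $\{w(\overline i),\lfloor wr_\gamma\rfloor(1)\}=\{1,a_2\}$, and $\lfloor wr_\gamma\rfloor(u)=w(u-1)$ for $u\in[2,i]$; in this case $\gamma^\vee=\varepsilon_i-\varepsilon_{i+1}=\alpha_i^\vee$. (q-D2) $i\in[2,n-2]$, $c_i(\gamma^\vee)=2$, $\lfloor wr_\gamma\rfloor(1)=w(\overline i)=1$, $\lfloor wr_\gamma\rfloor(2)=w(\overline{i-1})=2$, and $\lfloor wr_\gamma\rfloor(u)=w(u-2)$ for $u\in[3,i]$; in this case $\gamma^\vee=\varepsilon_{i-1}+\varepsilon_i=\alpha_{i-1}^\vee+2\alpha_i^\vee+2\alpha_{i+1}^\vee+\cdots+2\alpha_{n-2}^\vee+\alpha_{n-1}^\vee+\alpha_n^\vee$. (q-D3) $i=n-1$, $c_{n-1}(\gamma^\vee)=1$, $\lfloor wr_\gamma\rfloor(1)=w(n)=1$, $\lfloor wr_\gamma\rfloor(2)=\sigma(w(n-1))=2$,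 $\lfloor wr_\gamma\rfloor(s)=w(s-2)$ for $s\in[3,n-1]$, and $\lfloor wr_\gamma\rfloor(n)=\sigma(w(n-2))$; in this case $\gamma^\vee=\varepsilon_{n-1}-\varepsilon_n=\alpha_{n-1}^\vee$. (q-D4) $i=n$, $c_n(\gamma^\vee)=1$, $\lfloor wr_\gamma\rfloor(1)=\sigma(w(n))=1$, $\lfloor wr_\gamma\rfloor(2)=\sigma(w(n-1))=2$, and $\lfloor wr_\gamma\rfloor(s)=w(s-2)$ for $s\in[3,n]$; in this case $\gamma^\vee=\varepsilon_{n-1}+\varepsilon_n=\alpha_n^\vee$.
   Context: Write $[k]=\{1,\dots,k\}$ ($=\emptyset$ if $k\le0$), $[k,l]=\{k,\dots,l\}$ (empty if $k>l$). Let $\varepsilon_1,\dots,\varepsilon_n$ be an orthonormal basis of $\mathbb{R}^n$, $\Delta=\{\pm(\varepsilon_s\pm\varepsilon_t)\mid s<t\}$ (type $D_n$), simple roots $\alpha_s=\varepsilon_s-\varepsilon_{s+1}$ ($s\le n-1$), $\alpha_n=\varepsilon_{n-1}+\varepsilon_n$; roots and coroots are identified, and $c_i(\xi)$ is the coefficient of $\alpha_i^\vee$ in $\xi\in\bigoplus_i\mathbb{Z}\alpha_i^\vee$. Let $\mathcal D_n=\{1,\dots,n,\overline n,\dots,\overline1\}$, $\sigma:s\leftrightarrow\overline s$, $\|s\|=\|\overline s\|=s$. Identifying $s=\varepsilon_s$, $\overline s=-\varepsilon_s$, $W$ is the group of permutations $w$ of $\mathcal D_n$ with $w\sigma=\sigma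 w$ and $\#\{s\in[n]\mid w(s)\in\{\overline n,\dots,\overline1\}\}$ even. For $J\subset I$: $W_J=\langle r_j\mid j\in J\rangle$, $W^J$ is the set of minimal-length representatives of $W/W_J$, $\lfloor w\rfloor\in W^J$ the minimal representative of $wW_J$, $\Delta_J^+=\Delta^+\cap\bigoplus_{j\in J}\mathbb{Z}\alpha_j$, $\rho=\frac12\sum_{\alpha\in\Delta^+}\alpha$, $\rho_J=\frac12\sum_{\alpha\in\Delta_J^+}\alpha$. The (parabolic) quantum Bruhat graph $\mathrm{QB}^J$ has vertex set $W^J$ and edges $w\xrightarrow{\gamma}\lfloor wr_\gamma\rfloor$ for $w\in W^J$, $\gamma\in\Delta^+\setminus\Delta_J^+$ with $\ell(\lfloor wr_\gamma\rfloor)-\ell(w)=1-2\chi\langle\gamma^\vee,\rho-\rho_J\rangle$ for some $\chi\in\{0,1\}$; the edge is quantum if $\ell(\lfloor wr_\gamma\rfloor)-\ell(w)=1-2\langle\gamma^\vee,\rho-\rho_J\rangle$. *)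

(* Defs.v *)
From HB Require Import structures.
From mathcomp Require Import all_boot all_order all_algebra all_fingroup.

Set Implicit Arguments.
Unset Strict Implicit.
Unset Printing Implicit Defensive.

Import Order.TTheory GRing.Theory Num.Theory.
Local Open Scope ring_scope.

(* The index set [n] is 'I_n.-1.+1, i.e. 'I_n for n > 0, in a form that is     *)
(* visibly nonempty; k \in [n] is encoded by the ordinal of value k.-1.        *)
(* All integers of type nat below are 1-based, as on paper.                    *)
Definition idx (n k : nat) : 'I_n.-1.+1 := inord k.-1.

(* (s, false) is the letter s, and (s, true) is the letter \bar s.             *)
Definition Dn (n : nat) : finType := ('I_n.-1.+1 * bool)%type.

Section TypeD.
Variables (R : realFieldType) (n : nat).

Local Notation vec := ('rV[R]_n.-1.+1).
Local Notation D := (Dn n).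

Definition letter (k : nat) : D := (idx n k, false).
Definition bar (x : D) : D := (x.1, ~~ x.2).
Definition absl (x : D) : nat := x.1.+1.

Definition eps (x : D) : vec := (-1) ^+ x.2 *: delta_mx 0 x.1.
Definition e (k : nat) : vec := eps (letter k).

Definition dot (u v : vec) : R := \sum_k u 0 k * v 0 k.
Definition coroot (a : vec) : vec := (2 / dot a a) *: a.

(* As eps (bar x) = - eps x, these are the vectors +-(e s +- e t), s < t,      *)
(* each listed once.                                                           *)
Definition roots : seq vec :=
  [seq eps p.1 + eps p.2 | p <- enum [pred p : D * D | (absl p.1 < absl p.2)%N]].

Definition alpha (k : nat) : vec :=
  if (k < n)%N then e k - e k.+1 else e n.-1 + e n.

Definition root_coef (j : 'I_n.-1.+1) (v : vec) : R :=
  coord [tuple alpha k.+1 | k < n.-1.+1] j v.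

Definition coroot_coef (i : nat) (v : vec) : R :=
  coord [tuple coroot (alpha k.+1) | k < n.-1.+1] (idx n i) v.

Definition pos_roots : seq vec :=
  [seq a <- roots | [forall j, 0 <= root_coef j a]].

(* A root is an integral combination of all the simple roots, so it lies in    *)
(* the sum of the Z alpha_j, j \in J, when its other coefficients vanish.      *)
Definition pos_rootsJ (J : {set 'I_n.-1.+1}) : seq vec :=
  [seq a <- pos_roots | [forall (j | j \notin J), root_coef j a == 0]].

Definition rho : vec := 2^-1 *: \sum_(a <- pos_roots) a.
Definition rhoJ (J : {set 'I_n.-1.+1}) : vec :=
  2^-1 *: \sum_(a <- pos_rootsJ J) a.

Definition weylD : {set {perm D}} :=
  [set w : {perm D} | [forall x, w (bar x) == bar (w x)]
     && ~~ odd #|[set s : 'I_n.-1.+1 | (w (s, false)).2]| ].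

(* Products in {perm D} compose from left to right; wcomp is the usual w u.    *)
Definition wcomp (w u : {perm D}) : {perm D} := (u * w)%g.

(* The reflection v |-> v - <v, a^v> a, as a permutation of the vectors        *)
(* eps x; it exists and is unique when a is a root.                            *)
Definition refl (a : vec) : {perm D} :=
  odflt 1%g [pick r : {perm D} |
    [forall x, eps (r x) == eps x - dot (eps x) (coroot a) *: a]].

Definition simple_refls (J : {set 'I_n.-1.+1}) : {set {perm D}} :=
  [set refl (alpha j.+1) | j : 'I_n.-1.+1 in J].

(* Least k such that w is a product of k simple reflections. The search range  *)
(* is large enough: a reduced word is shorter than the order of the group.     *)
Definition ell (w : {perm D}) : nat :=
  find (fun k => w \in (simple_refls setT ^+ k)%g) (iota 0 #|{: {perm D}}|).

Section Parabolic.
Variable J : {set 'I_n.-1.+1}.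

Definition weylJ : {set {perm D}} := <<simple_refls J>>%g.

Definition cosetJ (w : {perm D}) : {set {perm D}} :=
  [set wcomp w u | u in weylJ].

Definition min_reps : {set {perm D}} :=
  [set w in weylD | [forall v in cosetJ w, (ell w <= ell v)%N]].

(* The minimal-length element of a coset is unique.                            *)
Definition floorJ (w : {perm D}) : {perm D} :=
  [arg min_(v < w in cosetJ w) ell v]%N.

Definition edge_eq (chi : bool) (w : {perm D}) (gamma : vec) (v : {perm D}) :=
  (ell v)%:R - (ell w)%:R
    = 1 - 2 * chi%:R * dot (coroot gamma) (rho - rhoJ J) :> R.

Definition qb_edge (w : {perm D}) (gamma : vec) (v : {perm D}) : Prop :=
  [/\ w \in min_reps, gamma \in pos_roots, gamma \notin pos_rootsJ J,
      v = floorJ (wcomp w (refl gamma))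
    & exists chi : bool, edge_eq chi w gamma v].

Definition quantum_edge (w : {perm D}) (gamma : vec) (v : {perm D}) : Prop :=
  qb_edge w gamma v /\ edge_eq true w gamma v.

End Parabolic.

Section Conditions.
Variables (i : nat) (w : {perm D}) (gamma : vec) (v : {perm D}).

(* The increasing sequence a_1 < ... < a_(n-i+1).                              *)
Definition free_abs : seq nat :=
  [seq s <- iota 1 n | s \notin [seq absl (w (letter u)) | u <- iota 1 i.-1]].
Definition a_ (k : nat) : nat := nth 0%N free_abs k.-1.

Definition qD1 : Prop :=
  [/\ (1 <= i <= n - 2)%N /\ coroot_coef i (coroot gamma) = 1,
      a_ 1 = 1%N,
      [set w (bar (letter i)); v (letter 1)] = [set letter 1; letter (a_ 2)]
    & forall u : nat, (2 <= u <= i)%N -> v (letter u) = w (letter (u - 1))].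

Definition qD2 : Prop :=
  [/\ (2 <= i <= n - 2)%N /\ coroot_coef i (coroot gamma) = 2,
      v (letter 1) = w (bar (letter i)) /\ w (bar (letter i)) = letter 1,
      v (letter 2) = w (bar (letter (i - 1)))
        /\ w (bar (letter (i - 1))) = letter 2
    & forall u : nat, (3 <= u <= i)%N -> v (letter u) = w (letter (u - 2))].

Definition qD3 : Prop :=
  [/\ i = (n - 1)%N /\ coroot_coef (n - 1) (coroot gamma) = 1,
      v (letter 1) = w (letter n) /\ w (letter n) = letter 1,
      v (letter 2) = bar (w (letter (n - 1)))
        /\ bar (w (letter (n - 1))) = letter 2,
      forall s : nat, (3 <= s <= n - 1)%N -> v (letter s) = w (letter (s - 2))
    & v (letter n) = bar (w (letter (n - 2)))].

Definition qD4 : Prop :=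
  [/\ i = n /\ coroot_coef n (coroot gamma) = 1,
      v (letter 1) = bar (w (letter n)) /\ bar (w (letter n)) = letter 1,
      v (letter 2) = bar (w (letter (n - 1)))
        /\ bar (w (letter (n - 1))) = letter 2
    & forall s : nat, (3 <= s <= n)%N -> v (letter s) = w (letter (s - 2))].

End Conditions.

End TypeD.

Arguments e R {n} k.
Arguments alpha R n k : clear implicits.
Arguments ell R {n} w.
Arguments min_reps R {n} J.
Arguments floorJ R {n} J w.
Arguments pos_roots R n : clear implicits.
Arguments pos_rootsJ R {n} J.

(* Main.v *)
Require Import Defs.
From mathcomp Require Import all_boot all_order all_algebra all_fingroup.
From mathcomp Require Import zify ring.

(* Let lambda be omega_i (doubled when i is a spin node), a vector with k      *)
(* entries +-1 and n - k entries 0. The length of a minimal representative w   *)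
(* is the number of positive roots on which w lambda is negative, so that      *)
(* l(w) - l(floor (w r_gamma)) only involves w lambda and the vector deduced   *)
(* from it by the reflection of root w gamma, which differ at two positions.   *)
(* On the other hand 2 (rho - rho_J) = (2n - k - 1) lambda, so the edge is     *)
(* quantum iff this difference is (2n - k - 1) c - 1, where                    *)
(* c = (gamma, lambda) is 1 (an entry +-1 is moved to the place of a 0) or 2   *)
(* (two entries change sign). Counting pairs of positions, a position r that   *)
(* is not changed contributes at most c (2 - |(w lambda)_r|) to the            *)
(* difference, and the changed pair at most 1. These bounds add up to          *)
(* (2n - k - 1) c - 1, so all of them are attained; this determines the signs  *)
(* near the two positions. As a minimal representative lists the letters of    *)
(* w lambda in increasing order, the conditions (q-D1)-(q-D4) can be read off. *)

(** Length is half of [#|inversions w|] ([ell_inversions]), each root being counted in both orders.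
    A minimal representative makes no root of [Delta_J^+] negative ([min_reps_gt0]), so its
    inversions can be counted on [w lambda] alone ([inversions_weight]). Together with [dot_rho]
    this turns the quantum condition into an equation between integers, [edge_eqE].

    Write [gamma = eps x + eps y] with [l x = 1] and [l y] equal to 0 or 1 ([root_letters]). In both
    cases the equation asks for the largest drop that position by position bounds allow, so
    [sum_eq_bound] splits it into one equality per position. If [l y = 0] ([neg_total_move]), an
    entry -1 leaves position [p] and an entry 1 appears at position [q]; one of them is the first
    position, and the signs strictly between them are forced. If [l y = 1] ([neg_total_flip]), the
    first two entries pass from -1 to 1.

    The values of a minimal representative along [chain] form a sorted list, determined by its set
    of letters ([column_eq]). The lists of [w] and [v] therefore share a block [S], followed in [w]
    by the letters that disappear and preceded in [v] by those that appear ([move_columns],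
    [flip_columns]). Reading off entries gives [qD1] in the first case, and [qD2], [qD3] or [qD4],
    depending on the node, in the second ([quantum_edge_cases]). *)

Set Implicit Arguments.
Unset Strict Implicit.
Unset Printing Implicit Defensive.

Import Order.TTheory GRing.Theory Num.Theory.
Local Open Scope ring_scope.

(** * Letters *)

Section Letters.
Variable m : nat.
Local Notation D := (Dn m.+1).
Implicit Types (x y z : D) (w u : {perm D}).

(* For x = s (resp. \bar s) this is n - s (resp. s - n), that is (eps x, rho); *)
(* hence eps x + eps y is a positive root iff height x + height y > 0.         *)
Definition height x : int := if x.2 then - (m - x.1)%:Z else (m - x.1)%:Z.

(** An odd function is what a linear map restricts to on the vectors [eps x]; heights and weights
    are handled in this form. *)
Definition oddf (V : zmodType) (g : D -> V) := forall x, g (bar x) = - g x.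
Definition signed w := forall x, w (bar x) = bar (w x).

Lemma bar1 x : (bar x).1 = x.1. Proof. by []. Qed.
Lemma bar2 x : (bar x).2 = ~~ x.2. Proof. by []. Qed.

Lemma barK : involutive (@bar m.+1).
Proof. by case=> s b; rewrite /bar /= negbK. Qed.

Lemma letter_eqE x y : (x == y) = (x.1 == y.1) && (x.2 == y.2).
Proof. by case: x y => [s b] [t c]; rewrite -pair_eqE. Qed.

Lemma bar_eq x y : (bar x == bar y) = (x == y).
Proof. exact: (inj_eq (inv_inj barK)). Qed.

Lemma eq_bar x y : (x == bar y) = (bar x == y).
Proof. by rewrite -bar_eq barK. Qed.

Lemma eq_bar_self x : (x == bar x) = false.
Proof. by rewrite letter_eqE bar2; case: x.2; rewrite andbF. Qed.

Lemma eq_abs x y : (x.1 == y.1) = (x == y) || (x == bar y).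
Proof. by rewrite !letter_eqE bar1 bar2; case: x.2 y.2 (x.1 == y.1) => [] [] []. Qed.

Lemma height_odd : oddf height.
Proof. by case=> s []; rewrite /height /= ?opprK. Qed.

Lemma absP x y : x.1 != y.1 ->
  [/\ (nat_of_ord x.1 <= m)%N,
    (nat_of_ord y.1 <= m)%N & nat_of_ord x.1 <> nat_of_ord y.1].
Proof.
move=> /eqP ne; split; [exact: (ltn_ord x.1) | exact: (ltn_ord y.1) |].
by move=> e; apply: ne; apply: val_inj.
Qed.

(** The entries of [rho] decrease strictly down to 0, so the letter of smaller absolute value
    decides the sign. *)
Lemma height_gt0 x y : x.1 != y.1 ->
  (0 < height x + height y) = if (x.1 < y.1)%N then ~~ x.2 else ~~ y.2.
Proof.
move=> /absP[]; rewrite /height; move: (nat_of_ord x.1) (nat_of_ord y.1) => a b.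
by case: ltnP; case: x.2; case: y.2 => /=; lia.
Qed.

Lemma height_neq0 x y : x.1 != y.1 -> height x + height y != 0.
Proof.
move=> /absP[]; rewrite /height; move: (nat_of_ord x.1) (nat_of_ord y.1) => a b.
by case: x.2; case: y.2 => /=; lia.
Qed.

Lemma abs_signed w x y : signed w -> ((w x).1 == (w y).1) = (x.1 == y.1).
Proof.
by move=> sw; rewrite !eq_abs -sw !(inj_eq perm_inj).
Qed.

Lemma signedV w : signed w -> signed w^-1%g.
Proof. by move=> sw x; apply: (@perm_inj _ w); rewrite permKV sw permKV. Qed.

Lemma signedM w u : signed w -> signed u -> signed (w * u)%g.
Proof. by move=> sw su x; rewrite !permM sw su. Qed.

Lemma signed1 : signed 1%g.
Proof. by move=> x; rewrite !perm1. Qed.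

(** The reflection in the root [eps x + eps y]: it sends [eps x] to [- eps y]. *)
Definition srefl x y : {perm D} := (tperm x (bar y) * tperm y (bar x))%g.

(* The scalar product of eps z with eps x + eps y. *)
Definition pairing x y z : int :=
  (z == x)%:Z + (z == y)%:Z - (z == bar x)%:Z - (z == bar y)%:Z.

Lemma abs_neqE x y : x.1 != y.1 ->
  [/\ (x == y) = false, (y == x) = false, (x == bar y) = false & (y == bar x) = false].
Proof.
by move=> nxy; split; apply/eqP=> e; rewrite e /= eqxx in nxy.
Qed.

Lemma sreflE x y z : x.1 != y.1 ->
  srefl x y z = if z == x then bar y else if z == y then bar x
           else if z == bar x then y else if z == bar y then x else z.
Proof.
move=> /abs_neqE[nxy nyx nxby nybx]; rewrite /srefl permM.
have [->|zx] := eqVneq z x.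
  by rewrite tpermL tpermD // ?bar_eq ?nxy // eq_bar_self.
have [->|zy] := eqVneq z y.
  by rewrite (@tpermD _ x) ?tpermL // ?nxy // eq_sym eq_bar_self.
have [->|zbx] := eqVneq z (bar x).
  by rewrite (@tpermD _ x) ?tpermR ?eq_bar_self // bar_eq nyx.
have [->|zby] := eqVneq z (bar y).
  by rewrite tpermR tpermD // ?nyx // eq_sym eq_bar_self.
by rewrite !tpermD // eq_sym.
Qed.

(** The reflection formula seen through a linear map; roots have square length 2, so [pairing] also
    gives the pairing with the coroot. *)
Lemma oddf_srefl (V : zmodType) (g : D -> V) x y z : oddf g -> x.1 != y.1 ->
  g (srefl x y z) = g z - (g x + g y) *~ pairing x y z.
Proof.
move=> og ne; rewrite sreflE // /pairing.
have [nxy nyx nxby nybx] := abs_neqE ne.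
have [->|zx] := eqVneq z x.
  rewrite eq_bar_self nxy nxby og.
  by rewrite !(addr0, subr0) mulr1z opprD addrA subrr add0r.
have [->|zy] := eqVneq z y.
  rewrite eq_bar_self nybx og.
  by rewrite !(addr0, subr0, add0r) mulr1z opprD addrCA subrr addr0.
have [->|zbx] := eqVneq z (bar x).
  rewrite bar_eq nxy og.
  by rewrite !(addr0, subr0, add0r) mulrN1z opprK addrA addNr add0r.
have [->|zby] := eqVneq z (bar y).
  rewrite og.
  by rewrite !(addr0, subr0, add0r) mulrN1z opprK addrCA addNr addr0.
by rewrite -[LHS]subr0.
Qed.

Lemma srefl_signed x y : x.1 != y.1 -> signed (srefl x y).
Proof.
move=> ne z; have [nxy nyx nxby nybx] := abs_neqE ne.
have nbx (t : D) : (bar t == t) = false by rewrite eq_sym eq_bar_self.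
have nbxy : (bar x == y) = false by rewrite -eq_bar.
have nbyx : (bar y == x) = false by rewrite -eq_bar.
have E := (nxy, nyx, nxby, nybx, nbx, nbxy, nbyx, bar_eq, barK, eqxx).
have [->|zx] := eqVneq z x; first by rewrite !sreflE // !E.
have [->|zy] := eqVneq z y; first by rewrite !sreflE // !E.
have [->|zbx] := eqVneq z (bar x); first by rewrite !sreflE // !E.
have [->|zby] := eqVneq z (bar y); first by rewrite !sreflE // !E.
rewrite !sreflE // !bar_eq -!eq_bar (negPf zx) (negPf zy) (negPf zbx) (negPf zby).
by [].
Qed.

Lemma srefl_invol x y : x.1 != y.1 -> involutive (srefl x y).
Proof.
move=> ne z; have [nxy nyx nxby nybx] := abs_neqE ne.
have nbx (t : D) : (bar t == t) = false by rewrite eq_sym eq_bar_self.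
have nbxy : (bar x == y) = false by rewrite -eq_bar.
have nbyx : (bar y == x) = false by rewrite -eq_bar.
have E := (nxy, nyx, nxby, nybx, nbx, nbxy, nbyx, bar_eq, barK, eqxx).
have [->|zx] := eqVneq z x; first by rewrite !(sreflE _ ne) !E.
have [->|zy] := eqVneq z y; first by rewrite !(sreflE _ ne) !E.
have [->|zbx] := eqVneq z (bar x); first by rewrite !(sreflE _ ne) !E.
have [->|zby] := eqVneq z (bar y); first by rewrite !(sreflE _ ne) !E.
have Ez : srefl x y z =
  z by rewrite sreflE // (negPf zx) (negPf zy) (negPf zbx) (negPf zby).
by rewrite !Ez.
Qed.

End Letters.

(** * Inversions of signed permutations *)

Section Inversions.
Variable m : nat.
Local Notation D := (Dn m.+1).
Implicit Types (x y z : D) (w u : {perm D}).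

(* Both orderings (x, y) and (y, x) of a root are counted. *)
Definition inversions w : {set D * D} :=
  [set p | [&& p.1.1 != p.2.1, 0 < height p.1 + height p.2
             & height (w p.1) + height (w p.2) < 0]].

Lemma in_inversions w z t : ((z, t) \in inversions w) =
  [&& z.1 != t.1, 0 < height z + height t & height (w z) + height (w t) < 0].
Proof. by rewrite inE. Qed.

Section SimpleReflection.
Variables x y : D.
Hypotheses (ne : x.1 != y.1) (hxy : height x + height y = 1).
Local Notation B := [set (x, y); (y, x)].

(** A root of height 1 is simple. The reflection lowers heights by the pairing with this root, which
    is at most 1 on every other root; so the new height is at least 0, and no root has height 0. *)
Lemma srefl_gt0 z t : z.1 != t.1 -> 0 < height z + height t ->
  (z, t) \notin B -> 0 < height (srefl x y z) + height (srefl x y t).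
Proof.
move=> nzt hp; rewrite !inE !xpair_eqE negb_or => /andP[n1 n2].
have nzt' : (srefl x y z).1 != (srefl x y t).1.
  by rewrite abs_signed //; apply: srefl_signed.
have := height_neq0 nzt'; rewrite lt_neqAle eq_sym => -> /=.
rewrite !(oddf_srefl _ (@height_odd m)) // hxy.
have [nzt0 _ _ _] := abs_neqE nzt; have [nxy nyx _ _] := abs_neqE ne.
have le1 r : pairing x y r <= ((r == x) || (r == y))%:Z.
  rewrite /pairing; have [->|_] := eqVneq r x; first rewrite nxy.
    by case: (x == bar x); case: (x == bar y).
  by case: (r == y); case: (r == bar x); case: (r == bar y).
suff : ~~ ([|| z == x | z == y] && [|| t == x | t == y]).
  move: (le1 z) (le1 t) hp;
    move: (height z) (height t) (pairing x y z) (pairing x y t) => a b c d.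
  by case: (_ || _); case: (_ || _) => //=; clear; lia.
apply/negP=> /andP[/orP[]/eqP ez /orP[]/eqP et]; move: nzt0 n1 n2;
  rewrite ez et ?eqxx //.
Qed.

Lemma srefl_gt0E z t : z.1 != t.1 ->
  (0 < height z + height t) && ((z, t) \notin B) =
  (0 < height (srefl x y z) + height (srefl x y t))
     && ((srefl x y z, srefl x y t) \notin B).
Proof.
have inv := srefl_invol ne; have sg := srefl_signed ne.
have fwd z' t' : z'.1 != t'.1 -> (0 < height z' + height t') && ((z', t') \notin B) ->
  (0 < height (srefl x y z') + height (srefl x y t'))
     && ((srefl x y z', srefl x y t') \notin B).
  move=> nzt /andP[h0 nB]; rewrite srefl_gt0 //=.
  (* If the reflected pair were the simple root, the pair itself would be its opposite, of height
     -1. *)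
  apply: contraL h0; rewrite !inE !xpair_eqE -leNgt.
  have [nxy nyx _ _] := abs_neqE ne.
  have sx : srefl x y x = bar y by rewrite sreflE // eqxx.
  have sy : srefl x y y = bar x by rewrite sreflE // nyx eqxx.
  rewrite -[X in _ -> height X + _ <= 0]inv -[X in _ -> _ + height X <= 0]inv.
  case/orP=> /andP[/eqP-> /eqP->]; rewrite sx sy !height_odd -opprD.
    by rewrite addrC hxy.
  by rewrite hxy.
move=> nzt; apply/idP/idP; first exact: fwd.
by move/fwd; rewrite !inv; apply; rewrite abs_signed.
Qed.

(** The simple reflection permutes the positive roots other than its own, and carries one set of
    inversions to the other. *)
Lemma inversionsD w :
  #|inversions (srefl x y * w) :\: B| = #|inversions w :\: B|.
Proof.
have inv := srefl_invol ne; have sg := srefl_signed ne.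
pose f (p : D * D) := (srefl x y p.1, srefl x y p.2).
have fK : involutive f by case=> z t; rewrite /f /= !inv.
rewrite -(on_card_preimset (f := f)); last by exists f => p _; apply: fK.
apply: eq_card => -[z t]; rewrite [LHS]inE /f in_setD in_setD !in_inversions.
rewrite !(permM (srefl x y)) ![(_, _).1]/= ![(_, _).2]/= !inv (abs_signed z t sg).
have [//|nzt] := boolP (z.1 == t.1); first by rewrite !andbF.
by rewrite /= !andbA ![(_ \notin _) && _]andbC (srefl_gt0E nzt).
Qed.

Lemma inversionsE w : signed w -> 
  #|inversions w| = ((height (w x) + height (w y) < 0)%R.*2 + #|inversions w :\: B|)%N.
Proof.
move=> sw; rewrite -(cardsID B); congr (_ + _)%N.
have nxy : (x, y) != (y, x).
  by have [nxy _ _ _] := abs_neqE ne; rewrite xpair_eqE nxy.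
case hw : (_ < 0).
  rewrite (_ : true.*2 = #|B|); last by rewrite cards2 nxy.
  apply: eq_card => -[z t].
  rewrite 2!inE andbC; case: (boolP (_ \in B)) => //.
  rewrite !inE !xpair_eqE => /orP[] /andP[/eqP-> /eqP->] /=.
    by rewrite ne hxy hw.
  by rewrite eq_sym ne addrC hxy addrC hw.
apply/eqP; rewrite cards_eq0; apply/eqP/setP=> -[z t].
rewrite 2!inE andbC in_set0; case: (boolP (_ \in B)) => //.
rewrite !inE !xpair_eqE => /orP[] /andP[/eqP-> /eqP->] /=.
  by rewrite hw !andbF.
by rewrite addrC [X in _ && (X < 0)]addrC hw !andbF.
Qed.

(** The simple root itself accounts for the whole change, which is 2 because of the two orders. One
    equation without subtraction covers both signs. *)
Lemma inversions_srefl w : signed w ->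
  (#|inversions (srefl x y * w)| + (height (w x) + height (w y) < 0)%R.*2 =
   #|inversions w| + (0 < height (w x) + height (w y))%R.*2)%N.
Proof.
move=> sw; have [_ nyx _ _] := abs_neqE ne.
rewrite (inversionsE sw) inversionsE; last exact: signedM (srefl_signed ne) sw.
rewrite inversionsD !(permM (srefl x y)) (sreflE x) // eqxx (sreflE y) // nyx eqxx
  !sw !height_odd.
by rewrite -opprD oppr_lt0 addrC [X in (0 < X)%R]addrC; lia.
Qed.

End SimpleReflection.

Lemma odd_sum (I : finType) (F : I -> bool) :
  odd #|[set s | F s]| = \big[addb/false]_s F s.
Proof.
rewrite -sum1_card big_mkcond /=.
rewrite (big_morph odd oddD (erefl : odd 0 = false)); apply: eq_bigr => s _.
by rewrite inE; case: (F s).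
Qed.

Definition parity w : bool := \big[addb/false]_(s : 'I_m.+1) (w (s, false)).2.

Lemma weylDE w : (w \in weylD m.+1) <-> signed w /\ ~~ parity w.
Proof.
rewrite inE odd_sum; split=> [/andP[/forallP sw ->]|[sw pw]].
  by split=> // x; apply/eqP.
by apply/andP; split=> //; apply/forallP=> x; rewrite sw.
Qed.

Lemma signed_snd w s b : signed w -> (w (s, b)).2 = (w (s, false)).2 (+) b.
Proof.
move=> sw; case: b; last by rewrite addbF.
by rewrite -[(s, true)]/(bar (s, false)) sw bar2 addbT.
Qed.

Lemma abs_inj w : signed w -> injective (fun s => (w (s, false) : D).1).
Proof. by move=> sw s t /eqP; rewrite abs_signed // => /eqP. Qed.

Lemma parityM u w : signed u -> signed w -> parity (u * w)%g = parity u (+) parity w.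
Proof.
move=> su sw; rewrite [parity w](reindex_inj (abs_inj su)) /= /parity -big_split /=.
apply: eq_bigr => s _; rewrite permM; case: (u (s, false)) => t b.
by rewrite signed_snd //= addbC.
Qed.

Lemma parity1 : parity 1%g = false.
Proof. by rewrite /parity big1 // => s _; rewrite perm1. Qed.

Lemma weylD_group : group_set (weylD m.+1).
Proof.
apply/group_setP; split; first by apply/weylDE; split;
  [exact: signed1 | rewrite parity1].
move=> u w /weylDE[su pu] /weylDE[sw pw]; apply/weylDE; split; first exact: signedM.
by rewrite parityM // (negPf pu) (negPf pw).
Qed.

(** The reflection either changes no sign or changes those at [x.1] and [y.1] together. *)
Lemma srefl_weylD x y : x.1 != y.1 -> srefl x y \in weylD m.+1.
Proof.
move=> ne; apply/weylDE; split; first exact: srefl_signed.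
rewrite /parity (bigD1 x.1) // (bigD1 y.1) 1?eq_sym //= big1 => [|s /andP[sx sy]].
  rewrite !sreflE //; case: x y ne => [s b] [t c] /= ne.
  rewrite !letter_eqE !bar1 !bar2 /= !eqxx (eq_sym t) (negPf ne).
  by case: b; case: c.
by rewrite sreflE // !letter_eqE !bar1 /= (negPf sx) (negPf sy).
Qed.

End Inversions.

(** * Roots, reflections and length *)

Section Vectors.
Variables (R : realFieldType) (m : nat).
Local Notation D := (Dn m.+1).
Implicit Types (x y z : D) (a b c : 'rV[R]_m.+1).

Lemma eps_odd : oddf (@eps R m.+1).
Proof. by case=> s []; rewrite /eps /= ?expr1z ?expr0z ?scaleN1r ?scale1r ?opprK. Qed.

Lemma dotDl a b c : dot (n := m.+1) (a + b) c =
  dot (n := m.+1) a c + dot (n := m.+1) b c.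
Proof. by rewrite /dot -big_split; apply: eq_bigr => s _; rewrite mxE mulrDl. Qed.

Lemma dotC a b : dot (n := m.+1) a b = dot (n := m.+1) b a.
Proof. by apply: eq_bigr => s _; rewrite mulrC. Qed.

Lemma dotZl k a b : dot (n := m.+1) (k *: a) b = k * dot (n := m.+1) a b.
Proof. by rewrite /dot mulr_sumr; apply: eq_bigr => s _; rewrite mxE mulrA. Qed.

Lemma dotDr a b c : dot (n := m.+1) a (b + c) =
  dot (n := m.+1) a b + dot (n := m.+1) a c.
Proof. by rewrite dotC dotDl !(dotC a). Qed.

Lemma dotZr k a b : dot (n := m.+1) a (k *: b) = k * dot (n := m.+1) a b.
Proof. by rewrite dotC dotZl dotC. Qed.

Lemma dot0r a : dot (n := m.+1) a 0 = 0.
Proof. by rewrite /dot big1 // => s _; rewrite mxE mulr0. Qed.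

Lemma dot_sumr I (r : seq I) (P : pred I) (F : I -> 'rV[R]_m.+1) a :
  dot (n := m.+1) a (\sum_(i <- r | P i) F i) =
    \sum_(i <- r | P i) dot (n := m.+1) a (F i).
Proof.
by rewrite (big_morph (dot (n := m.+1) a) (dotDr a) (dot0r a)).
Qed.

Lemma dot_eps a x : dot (n := m.+1) a (eps R x) = (-1) ^+ x.2 * a 0 x.1.
Proof.
rewrite /eps dotZr; congr (_ * _); rewrite /dot (bigD1 x.1) //= big1 => [|s ne].
  by rewrite mxE !eqxx mulr1 addr0.
by rewrite mxE (negPf ne) andbF mulr0.
Qed.

Lemma eps_coord x s : eps R x 0 s = (-1) ^+ x.2 * (s == x.1)%:R.
Proof. by rewrite !mxE eqxx. Qed.

Lemma dot_eps_eps x y :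
  dot (n := m.+1) (eps R x) (eps R y) = (x == y)%:R - (x == bar y)%:R.
Proof.
rewrite dot_eps eps_coord !letter_eqE bar1 bar2 [y.1 == _]eq_sym.
by case: (x.1 == y.1); case: x.2; case: y.2;
   rewrite /= ?expr1 ?expr0 ?mulr1 ?mulrNN ?mulN1r ?mul1r ?mulr1 ?subr0 ?sub0r ?subrr
     ?oppr0 ?opprK ?mulr0.
Qed.

Lemma dot_eps_root x y z :
  dot (n := m.+1) (eps R z) (eps R x + eps R y) = (pairing x y z)%:~R.
Proof. by rewrite dotDr !dot_eps_eps /pairing !rmorphB rmorphD /= addrACA addrA. Qed.

Lemma dot_root_root x y : x.1 != y.1 ->
  dot (n := m.+1) (eps R x + eps R y) (eps R x + eps R y) = 2.
Proof.
move=> ne; have [nxy nyx nxby nybx] := abs_neqE ne.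
rewrite dotDl !dot_eps_root /pairing !eqxx nxy nyx nxby nybx !eq_bar_self.
by rewrite -rmorphD.
Qed.

Lemma coroot_root x y : x.1 != y.1 ->
  coroot (n := m.+1) (eps R x + eps R y) = eps R x + eps R y.
Proof. by move=> ne; rewrite /coroot dot_root_root // divff ?scale1r // pnatr_eq0. Qed.

Lemma eps_inj : injective (@eps R m.+1).
Proof.
move=> x y e; have := dot_eps_eps x x; rewrite {2}e dot_eps_eps eqxx eq_bar_self subr0.
case: eqVneq => // nxy; case: eqVneq => _; rewrite ?subr0 ?sub0r => /eqP.
  by rewrite eq_sym -subr_eq0 opprK -(natrD _ 1 1) pnatr_eq0.
by rewrite eq_sym oner_eq0.
Qed.

(** [srefl x y] satisfies the property searched for in [refl], and injectivity of [eps] makes the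
    solution unique. *)
Lemma reflE x y : x.1 != y.1 -> refl (n := m.+1) (eps R x + eps R y) = srefl x y.
Proof.
move=> ne; rewrite /refl coroot_root //.
have E z : eps R (srefl x y z) = eps R z
   - dot (n := m.+1) (eps R z) (eps R x + eps R y) *: (eps R x + eps R y).
  by rewrite (oddf_srefl _ eps_odd) // dot_eps_root scaler_int.
case: pickP => [r /forallP rP|/(_ (srefl x y))/forallP[] z]; last by rewrite E.
by apply/permP=> z; apply: eps_inj; rewrite E; apply/eqP.
Qed.

End Vectors.

(** * Simple reflections and the length function *)

Section SimpleRoots.
Variables (R : realFieldType) (m : nat) (m_gt0 : (0 < m)%N).
Local Notation D := (Dn m.+1).
Implicit Types (x y z : D) (w u : {perm D}) (j : 'I_m.+1).

Lemma idxK k : (0 < k <= m.+1)%N -> idx m.+1 k = k.-1 :> nat.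
Proof. by move=> ?; rewrite /idx inordK //; lia. Qed.

(** With [simple2], writes the simple root [alpha_(j+1)] as a sum of two [eps]; here [j] counts from
    0. *)
Definition simple1 (j : nat) : D := letter m.+1 (if (j < m)%N then j.+1 else m).
Definition simple2 (j : nat) : D :=
  if (j < m)%N then bar (letter m.+1 j.+2) else letter m.+1 m.+1.

Lemma alphaE (j : nat) : (j <= m)%N ->
  alpha R m.+1 j.+1 = eps R (simple1 j) + eps R (simple2 j).
Proof.
move=> jm; rewrite /alpha ltnS /simple1 /simple2; case: ifP => // jlt.
by rewrite eps_odd.
Qed.

Lemma simple_abs (j : nat) : (j <= m)%N -> (simple1 j).1 != (simple2 j).1.
Proof.
move=> jm; apply/eqP=> /(congr1 val) /=; rewrite /simple1 /simple2.
by case: ltnP => jlt /=; rewrite !idxK //; lia.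
Qed.

Lemma height_simple (j : nat) : (j <= m)%N ->
  height (simple1 j) + height (simple2 j) = 1.
Proof.
move=> jm; rewrite /simple1 /simple2.
by case: ltnP => jlt /=; rewrite /height /= !idxK //; lia.
Qed.

Lemma ord1_eta (s : 'I_m.+1) : idx m.+1 s.+1 = s.
Proof. by apply: val_inj; rewrite /= idxK //=; case: s. Qed.

Lemma height_le x : height x <= m.
Proof. by rewrite /height; case: x => [[s sm] b] /=; case: b; lia. Qed.

Lemma height_inj x y : height x = height y -> height x != 0 -> x = y.
Proof.
case: x y => [[s sm] b] [[t tm] c]; rewrite /height /= => e ne.
have est : s = t by move: e ne; case: b; case: c; lia.
subst t; rewrite (bool_irrelevance sm tm); congr (_, _).
by move: e ne; case: b; case: c; lia.
Qed.

(** The heights of the images of the letters 1, ..., n decrease strictly, and the bounds at the two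
    ends leave only the values taken at the identity. *)
Lemma no_descent w : w \in weylD m.+1 ->
  (forall j : nat, (j <= m)%N -> 0 < height (w (simple1 j)) + height (w (simple2 j))) ->
  w = 1%g.
Proof.
move=> /weylDE[sw pw] pos.
pose a k := height (w (letter m.+1 k.+1)).
have step k : (k < m)%N -> a k.+1 < a k.
  move=> km; have := pos k (ltnW km); rewrite /simple1 /simple2 km sw height_odd.
  by rewrite subr_gt0.
have last1 : 0 < a m.-1 + a m.
  by have := pos m (leqnn _); rewrite /simple1 /simple2 ltnn /a prednK.
have up k : (k <= m)%N -> a k <= (m - k)%N.
  elim: k => [|k IH] km; first by rewrite subn0 height_le.
  by have := step _ km; have := IH (ltnW km); lia.
(* Counted from the end: [a m < a m.-1] and [0 < a m.-1 + a m] give [1 <= a m.-1]. *)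
have down k : (k < m)%N -> (k.+1 : int) <= a (m - k.+1)%N.
  elim: k => [|k IH] km.
    have := step m.-1; rewrite subn1; move: last1; rewrite prednK //; lia.
  have := IH (ltnW km); have := step (m - k.+2)%N.
  by rewrite (_ : (m - k.+2).+1 = (m - k.+1)%N); lia.
have ak k : (k < m)%N -> a k = (m - k)%N.
  move=> km; have := up k (ltnW km); have := down (m - k.+1)%N.
  by rewrite (_ : (m - (m - k.+1).+1)%N = k); lia.
have am : a m = 0.
  have := step m.-1; have := ak m.-1; move: last1; have := up m (leqnn _);
    rewrite prednK //; lia.
have fixlt k : (k < m)%N -> w (letter m.+1 k.+1) = letter m.+1 k.+1.
  move=> km; apply: height_inj; rewrite -/(a k) ak //; last lia.
  by rewrite /height /= idxK //; lia.
have fixm : (w (letter m.+1 m.+1)).1 = idx m.+1 m.+1.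
  apply/val_inj; rewrite /= idxK /= ?leqnn //; move: am; rewrite /a /height.
  case: (w _) => [[s sm] b] /=; case: b; lia.
have fix1 s : (w (s, false)).1 = s /\ (s != ord_max -> (w (s, false)).2 = false).
  have [sm|sm] := ltnP s m.
    by have := fixlt s sm; rewrite /letter ord1_eta => ->.
  have -> : s = ord_max by apply: val_inj => /=; case: s sm => /= s; lia.
  by rewrite eqxx; split=> //; move: fixm; rewrite /letter (ord1_eta ord_max).
(* The letters n and [\bar n] both have height 0; only the parity distinguishes the two possible
   images of n. *)
have fixsgn : (w (ord_max, false)).2 = false.
  apply/negbTE; move: pw; rewrite /parity (bigD1 ord_max) //= big1 ?addbF // => s sm.
  by apply: (fix1 s).2.
apply/permP=> -[s b]; rewrite perm1.
suff E : w (s, false) = (s, false).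
  by case: b => //; rewrite -[(s, true)]/(bar (s, false)) sw E.
have [e1 e2] := fix1 s; apply/eqP; rewrite letter_eqE e1 eqxx /=; apply/eqP.
by have [->|/e2] := eqVneq s ord_max.
Qed.

Lemma refl_simple j : refl (alpha R m.+1 j.+1) = srefl (simple1 j) (simple2 j).
Proof. by have jm : (j <= m)%N := ltn_ord j; rewrite alphaE // reflE // simple_abs. Qed.

Lemma refl_simpleP (J : {set 'I_m.+1}) (r : {perm D}) :
  reflect (exists2 j : 'I_m.+1, j \in J & r = srefl (simple1 j) (simple2 j))
    (r \in simple_refls R (n := m.+1) J).
Proof.
by apply: (iffP imsetP) => -[j jJ ->]; exists j; rewrite ?refl_simple.
Qed.

Lemma simple_refls_weylD (J : {set 'I_m.+1}) :
  simple_refls R (n := m.+1) J \subset weylD m.+1.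
Proof.
apply/subsetP=> r /refl_simpleP[j _ ->]; apply: srefl_weylD.
by apply: simple_abs; apply: (ltn_ord j).
Qed.

Lemma inversions1 : #|inversions (1%g : {perm D})| = 0%N.
Proof.
apply/eqP; rewrite cards_eq0; apply/eqP/setP=> -[x y].
rewrite in_inversions !perm1 in_set0; apply/negP=> /and3P[_ h1 h2].
by have := lt_trans h1 h2; rewrite ltxx.
Qed.

Lemma inversions_le k w :
  w \in (simple_refls R (n := m.+1) setT ^+ k)%g -> (#|inversions w| <= k.*2)%N.
Proof.
elim: k w => [|k IH] w.
  by rewrite expg0 => /set1P ->; rewrite inversions1.
rewrite expgS => /mulsgP[r u /refl_simpleP[j _ ->] uk ->].
have jm : (j <= m)%N := ltn_ord j.
have [su _] : signed u /\ ~~ parity u.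
  apply/weylDE; move: uk; elim: {IH} k u => [|k IH] u.
    by rewrite expg0 => /set1P ->; apply: (group1 (Group (weylD_group m))).
  rewrite expgS => /mulsgP[r' u' /(subsetP (simple_refls_weylD _)) r'W /IH u'W ->].
  exact: (groupM (G := Group (weylD_group m))).
have := inversions_srefl (simple_abs jm) (height_simple jm) su; have := IH u uk.
move: #|inversions u| #|inversions (_ * u)| => b a; by case: (_ < 0);
  case: (0 < _) => /=; clear; lia.
Qed.

(** By [no_descent], a nontrivial [w] makes some simple root negative; composing with that
    reflection removes two inversions, and induction applies. *)
Lemma inversions_mem w : w \in weylD m.+1 ->
  exists2 k, #|inversions w| = k.*2 & w \in (simple_refls R (n := m.+1) setT ^+ k)%g.
Proof.
have [N eN] := ubnP #|inversions w|; elim: N w eN => // N IH w eN wW.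
have [->|w1] := eqVneq w 1%g.
  by exists 0%N; rewrite ?inversions1 // expg0 set11.
have [j jm des] : exists2 j : 'I_m.+1,
  (j <= m)%N & height (w (simple1 j)) + height (w (simple2 j)) <= 0.
  have [/existsP[j jP]|/existsPn asc] := boolP [exists j : 'I_m.+1,
      height (w (simple1 j)) + height (w (simple2 j)) <= 0].
    by exists j => //; apply: (ltn_ord j).
  case/eqP: w1; apply: no_descent => // j jm.
  by rewrite ltNge; apply: (asc (Ordinal (jm : (j < m.+1)%N))).
have [sw pw] := (weylDE w).1 wW.
have ne := simple_abs jm.
have := height_neq0 (x := w (simple1 j)) (y := w (simple2 j)).
rewrite abs_signed // => /(_ ne) nz.
have := inversions_srefl ne (height_simple jm) sw.
rewrite (lt_neqAle _ 0) nz des ltNge des /= addn0 => eI.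
set r := srefl _ _ in eI; set u := (r * w)%g in eI.
have uW : u \in weylD m.+1.
  by apply: (groupM (G := Group (weylD_group m))) => //; apply: srefl_weylD.
have [k ek uk] : exists2 k,
  #|inversions u| = k.*2 & u \in (simple_refls R (n := m.+1) setT ^+ k)%g.
  by apply: (IH _ _ uW); move: eN; rewrite -eI addn2 !ltnS => /ltnW.
exists k.+1; first by rewrite -eI ek addn2.
rewrite expgS; apply/mulsgP; exists r u => //.
  by apply/refl_simpleP; exists j; rewrite ?inE.
rewrite /u mulgA (_ : r * r = 1)%g ?mul1g //.
by apply/permP=> z; rewrite (permM r) perm1 srefl_invol.
Qed.

Lemma ell_inversions w : w \in weylD m.+1 -> (ell R w).*2 = #|inversions w|.
Proof.
move=> wW; have [k ek wk] := inversions_mem wW.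
suff -> : ell R w = k by [].
rewrite /ell; set p := fun _ => _; set N := #|_|.
(* The search range of [ell] suffices: with [d = #|D| >= 3], [2 k <= d^2] gives
   [k < d (d - 1) <= d!]. *)
have kN : (k < N)%N.
  have <- : #|perm_on [set: D]| = N.
    by apply: eq_card => r; rewrite !inE; apply/subsetP=> x; rewrite inE.
  have : (k.*2 <= #|{: D}| * #|{: D}|)%N.
    by rewrite -ek (leq_trans (max_card _)) // card_prod.
  have : (2 < #|{: D}|)%N by rewrite card_prod card_ord card_bool; lia.
  rewrite card_perm cardsT; case: #|_| => [|[|[|q]]] // _ kq.
  apply: (@leq_trans (q.+3 * q.+2)); first by move: kq; clear; nia.
  by rewrite !(factS q.+2, factS q.+1) leq_mul2l leq_pmulr // fact_gt0.
have pk : p k by [].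
have pge l : p l -> (k <= l)%N by move/inversions_le; rewrite ek leq_double.
have has_p : has p (iota 0 N) by apply/hasP; exists k; rewrite ?mem_iota.
have fN : (find p (iota 0 N) < N)%N by rewrite -{2}(size_iota 0 N) -has_find.
apply/eqP; rewrite eqn_leq; apply/andP; split.
  rewrite leqNgt; apply/negP=> /(before_find 0%N).
  by rewrite nth_iota // add0n pk.
by have := nth_find 0%N has_p; rewrite nth_iota // add0n; apply: pge.
Qed.

End SimpleRoots.

(** * Fundamental weights and positive roots *)

Section FundamentalWeights.
Variables (R : realFieldType) (m : nat) (m_gt0 : (0 < m)%N).
Local Notation D := (Dn m.+1).
Implicit Types (x y z : D) (w u : {perm D}) (j : nat).

(* weight j x is (eps x, omega_(j+1)), doubled for the two spin weights so as  *)
(* to be an integer.                                                           *)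
Definition weight j x : int :=
  let c : int := if (j.+1 < m)%N then (x.1 <= j)%N%:Z
                 else if (j < m)%N && (x.1 == m :> nat) then -1 else 1 in
  if x.2 then - c else c.

Definition weight_den j : nat := if (j.+1 < m)%N then 1 else 2.

Lemma weight_odd j : oddf (weight j).
Proof. by case=> s []; rewrite /weight /= ?opprK. Qed.

(** Fundamental weights are dual to the simple coroots, here also the simple roots; [weight_den]
    undoes the doubling at spin nodes. *)
Lemma weight_simple j k : (j <= m)%N -> (k <= m)%N ->
  weight j (simple1 m k) + weight j (simple2 m k) =
    if j == k then (weight_den j)%:Z else 0.
Proof.
move=> jm km; rewrite /weight /weight_den /simple1 /simple2.
case: (ltnP k m) => kltm /=; rewrite !idxK ?ltnS //=; try lia.
  by case: (ltnP j m) => ?; case: ifP => jlt; do ?case: leqP => ?;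
    do ?case: eqP => ? //=; lia.
by case: (ltnP j m) => ?; case: ifP => jlt; do ?case: leqP => ?;
  do ?case: eqP => ? //=; lia.
Qed.

(** Fundamental weights are dominant: the letter of smaller absolute value is unbarred, and its
    entry is at least the other one in absolute value. *)
Lemma weight_ge0 j x y : x.1 != y.1 -> 0 < height x + height y ->
  0 <= weight j x + weight j y.
Proof.
move=> ne; rewrite height_gt0 //; have [xm ym nxy] := absP ne.
rewrite /weight; move: (nat_of_ord x.1) (nat_of_ord y.1) xm ym nxy => a b am bm nab.
by case: ltnP => ab; case: x.2 => //; case: y.2 => //= _; case: ifP => jm;
  do ?case: leqP => ?; do ?case: eqP => ? //=; lia.
Qed.

Lemma weight_bound j x : `|weight j x| <= 1.
Proof. by rewrite /weight; case: x.2; (case: ifP => _;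
  [case: (x.1 <= j)%N | case: (_ && _)]). Qed.

Definition weight_vec j : 'rV[R]_m.+1 :=
  \row_s ((weight_den j)%:R^-1 * (weight j (s, false))%:~R).

Lemma dot_odd (g : D -> int) (c : R) x : oddf g ->
  dot (n := m.+1) (\row_s (c * (g (s, false))%:~R)) (eps R x) = c * (g x)%:~R.
Proof.
move=> og; rewrite dot_eps mxE; case: x => s [] /=; last by rewrite mul1r.
by rewrite -[(s, true)]/(bar (s, false)) og rmorphN mulN1r mulrN.
Qed.

Lemma dot_weight_root j x y : dot (n := m.+1) (weight_vec j) (eps R x + eps R y)
  = (weight_den j)%:R^-1 * (weight j x + weight j y)%:~R.
Proof. by rewrite dotDr !dot_odd //;
  [rewrite -mulrDr -rmorphD | apply: weight_odd..]. Qed.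

Local Notation simple_roots := [tuple alpha R m.+1 k.+1 | k < m.+1].

Lemma weight_den_neq0 j : (weight_den j)%:R != 0 :> R.
Proof. by rewrite /weight_den pnatr_eq0; case: ifP. Qed.

Lemma dot_weight_alpha j k : (j <= m)%N -> (k <= m)%N ->
  dot (n := m.+1) (weight_vec j) (alpha R m.+1 k.+1) = (j == k)%:R.
Proof.
move=> jm km; rewrite alphaE // dot_weight_root weight_simple //.
by case: eqP => _; rewrite ?mulr0 // mulVf ?weight_den_neq0.
Qed.

Lemma simple_rootsE (k : 'I_m.+1) : simple_roots`_k = alpha R m.+1 k.+1.
Proof. by rewrite -tnth_nth tnth_mktuple. Qed.

Lemma simple_roots_free : free simple_roots.
Proof.
apply/freeP => k k0 j; have := congr1 (dot (n := m.+1) (weight_vec j)) k0.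
rewrite dot0r dot_sumr (bigD1 j) //= big1 => [|s ne].
  by rewrite simple_rootsE dotZr dot_weight_alpha -1?ltnS // eqxx mulr1 addr0.
rewrite simple_rootsE dotZr dot_weight_alpha -1?ltnS //.
by rewrite eq_sym (negPf (ne : s != j :> nat)) mulr0.
Qed.

(** By duality, the coordinates of a vector are its scalar products with the fundamental weights. *)
Lemma simple_roots_basis (v : 'rV[R]_m.+1) :
  v = \sum_(j < m.+1) dot (n := m.+1) (weight_vec j) v *: alpha R m.+1 j.+1.
Proof.
have B : basis_of fullv simple_roots.
  rewrite basisEfree simple_roots_free subvf dimvf size_tuple dim_matrix. exact:
    (eq_leq (mul1n m.+1)).
rewrite {1}(coord_basis B (memvf v)); apply: eq_bigr => j _.
rewrite simple_rootsE {2}(coord_basis B (memvf v)) dot_sumr (bigD1 j) //= big1 =>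
  [|s ne].
  by rewrite simple_rootsE dotZr dot_weight_alpha -1?ltnS // eqxx mulr1 addr0.
rewrite simple_rootsE dotZr dot_weight_alpha -1?ltnS //.
by rewrite eq_sym (negPf (ne : s != j :> nat)) mulr0.
Qed.

Lemma root_coefE (j : 'I_m.+1) (v : 'rV[R]_m.+1) :
  root_coef (n := m.+1) j v = dot (n := m.+1) (weight_vec j) v.
Proof.
rewrite /root_coef {1}(simple_roots_basis v).
rewrite -[RHS](coord_sum_free (fun j :
  'I_m.+1 => dot (n := m.+1) (weight_vec j) v) j simple_roots_free).
by congr coord; apply: eq_bigr => s _; rewrite simple_rootsE.
Qed.

Lemma coroot_coefE i v :
  coroot_coef (R := R) (n := m.+1) i v = root_coef (n := m.+1) (idx m.+1 i) v.
Proof.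
rewrite /coroot_coef /root_coef; congr coord; apply: eq_mktuple => k.
have km : (k <= m)%N by rewrite -ltnS.
by rewrite alphaE // coroot_root // simple_abs.
Qed.

Lemma root_coef_root (j : 'I_m.+1) x y : root_coef (n := m.+1) j (eps R x + eps R y)
  = (weight_den j)%:R^-1 * (weight j x + weight j y)%:~R.
Proof. by rewrite root_coefE dot_weight_root. Qed.

(* Expansion of a root in the simple roots, seen through a linear form g.      *)
Lemma oddf_root (g : D -> int) x y : oddf g -> (g x + g y)%:~R =
  \sum_(j < m.+1) (weight_den j)%:R^-1 * (weight j x + weight j y)%:~R
     * (g (simple1 m j) + g (simple2 m j))%:~R :> R.
Proof.
move=> og; pose c := \row_s (1 * (g (s, false))%:~R) : 'rV[R]_m.+1.
have E z t : dot (n := m.+1) c (eps R z + eps R t) = (g z + g t)%:~R.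
  by rewrite dotDr !dot_odd // !mul1r rmorphD.
rewrite -E (simple_roots_basis (eps R x + eps R y)) dot_sumr; apply: eq_bigr => j _.
by rewrite dotZr dot_weight_root alphaE -1?ltnS // E.
Qed.

(** Every simple root has height 1, so the height is the sum of the coefficients; conversely each
    coefficient is the value of a dominant weight. *)
Lemma pos_coef x y : x.1 != y.1 ->
  [forall j : 'I_m.+1, 0 <= root_coef (n := m.+1) j (eps R x + eps R y)] =
    (0 < height x + height y).
Proof.
move=> ne; apply/forallP/idP => [pos|pos j].
  rewrite lt_neqAle eq_sym height_neq0 //= -(ler0z R) (oddf_root x y (@height_odd m)).
  apply: sumr_ge0 => j _; rewrite height_simple -1?ltnS // mulr1.
  by have := pos j; rewrite root_coef_root.
rewrite root_coef_root mulr_ge0 ?invr_ge0 ?ler0n // ler0z.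
exact: weight_ge0.
Qed.

Lemma lt_abs_neq x y : (x.1 < y.1)%N -> x.1 != y.1.
Proof. by move=> xy; apply/eqP => e; rewrite e ltnn in xy. Qed.

Lemma in_pos_roots (a : 'rV[R]_m.+1) : a \in pos_roots R m.+1 ->
  exists x y, [/\ a = eps R x + eps R y, x.1 != y.1 & 0 < height x + height y].
Proof.
rewrite mem_filter => /andP[pos /mapP[[x y] + e]]; rewrite mem_enum inE /= ltnS => xy.
have ne := lt_abs_neq xy; by exists x, y; split=> //; rewrite -pos_coef // -e.
Qed.

Lemma sum_pos_roots (F : 'rV[R]_m.+1 -> R) :
  \sum_(a <- pos_roots R m.+1) F a =
  \sum_(p : D * D | (p.1.1 < p.2.1)%N && (0 < height p.1 + height p.2)) F (eps R p.1
    + eps R p.2).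
Proof.
rewrite big_filter big_map big_enum_cond /=; apply: eq_bigl => -[x y] /=.
rewrite inE ltnS /=; case: ltnP => //= xy; exact: pos_coef (lt_abs_neq xy).
Qed.

Lemma pos_rootsJE (i : 'I_m.+1) : pos_rootsJ R (n := m.+1) [set~ i] =
  [seq a <- pos_roots R m.+1 | root_coef (n := m.+1) i a == 0].
Proof.
apply: eq_filter => a; apply/forall_inP/idP => [/(_ i)|h j];
  first by rewrite !inE eqxx; apply.
by rewrite !inE negbK => /eqP ->.
Qed.

(** Passing from roots listed once to ordered pairs allows the sum over one letter to be carried out
    with the other one fixed. *)
Lemma sum_ordered (G : D -> D -> R) (P : D -> D ->
  bool) : (forall x y, P x y = P y x) ->
  \sum_(p : D * D | (p.1.1 < p.2.1)%N && P p.1 p.2) (G p.1 p.2 + G p.2 p.1) =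
  \sum_(p : D * D | (p.1.1 != p.2.1) && P p.1 p.2) G p.1 p.2.
Proof.
move=> Psym; rewrite big_split /= [RHS](bigID (fun p : D * D => (p.1.1 < p.2.1)%N)) /=.
congr (_ + _).
  apply: eq_bigl => -[x y] /=; rewrite -andbA [_ && (_ < _)%N]andbC andbA;
    congr (_ && _).
  by case: ltnP => //= xy; rewrite ?andbT ?andbF // (lt_abs_neq xy).
rewrite [RHS](reindex_inj (h := fun p : D * D => (p.2, p.1))) /=;
  last by move=> [? ?] [? ?] /= [-> ->].
apply: eq_bigl => -[x y] /=;
  rewrite [in RHS]Psym -leqNgt -andbA [P _ _ && _]andbC andbA; congr (_ && _).
by rewrite ltn_neqAle eq_sym.
Qed.

End FundamentalWeights.

(** * Minimal representatives and the edge equation *)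

Section Parabolic.
Variables (R : realFieldType) (m : nat) (m_gt0 : (0 < m)%N).
Local Notation D := (Dn m.+1).
Implicit Types (x y z : D) (w u v : {perm D}).

Lemma sum_letters (V : zmodType) (P : pred 'I_m.+1) (F : D -> V) :
  \sum_(t : D | P t.1) F t = \sum_(s | P s) (F (s, false) + F (s, true)).
Proof.
transitivity (\sum_(s | P s) \sum_(b : bool) F (s, b)).
  by rewrite pair_big /=; apply: eq_big => [[s b]|[s b] _] //=; rewrite andbT.
by apply: eq_bigr => s _; rewrite big_bool /= addrC.
Qed.

Lemma int3P (a : int) : `|a| <= 1 -> [\/ a = 0, a = 1 | a = -1].
Proof.
by case: a => [[|[|n]]|[|n]] // _; [apply: Or31 | apply: Or32 | apply: Or33].
Qed.

(** For values in -1, 0, 1 this is the number [k] of nonzero entries. *)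
Definition abs_sum (l : D -> int) : int := \sum_(s : 'I_m.+1) `|l (s, false)|.

(** A position [s] other than that of [x] contributes [(2 - |l s|) l x]. *)
Lemma sum_positive_roots (l : D -> int) x : oddf l -> (forall z, `|l z| <= 1) ->
  (\sum_(t : D | x.1 != t.1) (0 < l x + l t)%R%:Z)
    - (\sum_(t : D | x.1 != t.1) (0 < l (bar x) + l t)%R%:Z)
  = (m.+1.*2%:Z - abs_sum l - 1) * l x.
Proof.
move=> lo lb; rewrite !(sum_letters (fun s => x.1 != s)) -sumrB.
rewrite (eq_bigr (fun s => (2 - `|l (s, false)|) * l x)); last first.
  move=> s _; rewrite -[(s, true)]/(bar (s, false)) !lo.
  by case: (int3P (lb x)) => ->; case: (int3P (lb (s, false))) => ->.
rewrite -mulr_suml.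
have -> : \sum_(s | x.1 != s) (2 - `|l (s,
  false)|) = m.+1.*2%:Z - abs_sum l - (2 - `|l x|).
  have -> : m.+1.*2%:Z - abs_sum l = \sum_(s : 'I_m.+1) (2 - `|l (s, false)|).
    rewrite sumrB sumr_const card_ord -mul2n PoszM -[2 *+ _]mulr_natr;
      congr (_ * _ - _); exact: (esym (natz _)).
  rewrite [in RHS](bigD1 x.1) //= (eq_bigl (fun s => s != x.1)) => [|s];
    last by rewrite eq_sym.
  have -> : `|l x| = `|l (x.1, false)|.
    by case: x => s [] //=; rewrite -[(s, true)]/(bar (s, false)) lo normrN.
  by rewrite [in RHS]addrAC subrr add0r.
(* If [l x = 0] both sides vanish; otherwise [2 - |l x| = 1]. *)
by rewrite !mulrBl; case: (int3P (lb x)) => ->.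
Qed.

Section MaximalParabolic.
Variable i : 'I_m.+1.
Local Notation J := [set~ i].
Local Notation l := (weight (m := m) i).

(** Dominance is applied to a root and to its opposite; the roots obtained are those of [Delta^+]
    outside [Delta_J^+]. *)
Lemma weight_neq0E x y : x.1 != y.1 ->
  (0 < height x + height y) && (l x + l y != 0) = (0 < l x + l y).
Proof.
move=> ne; case: ltP => [/(weight_ge0 m_gt0 i ne)|hle] /=;
  first by rewrite lt0r => ->; rewrite andbT.
have ne' : (bar x).1 != (bar y).1 by [].
have := weight_ge0 m_gt0 i ne';
  rewrite !height_odd !weight_odd -!opprD !oppr_gt0 !oppr_ge0.
by rewrite lt_neqAle height_neq0 // hle => /(_ isT); case: ltgtP.
Qed.

Lemma sum_pairing (F : D -> int) x y :
  \sum_z pairing x y z * F z = F x + F y - F (bar x) - F (bar y).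
Proof.
have E t : \sum_z (z == t)%:Z * F z = F t.
  rewrite (bigD1 t) //= eqxx mul1r big1 ?addr0 // => z /negPf ->.
  by rewrite mul0r.
rewrite (eq_bigr (fun z => (z == x)%:Z * F z + (z == y)%:Z * F z
   - (z == bar x)%:Z * F z - (z == bar y)%:Z * F z)) => [|z _].
  by rewrite !sumrB big_split /= !E.
by rewrite /pairing !mulrBl mulrDl.
Qed.

(** Twice [rho - rhoJ] is the sum of the roots on which [lambda] is positive. Pairing it with
    [eps x + eps y] leaves only the letters [x], [y] and their bars, for which [sum_positive_roots]
    does the count. *)
Lemma dot_rho x y : x.1 != y.1 ->
  2 * dot (n := m.+1) (eps R x + eps R y) (rho R m.+1 - rhoJ R (n := m.+1) J)
  = ((m.+1.*2%:Z - abs_sum l - 1) * (l x + l y))%:~R.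
Proof.
move=> ne.
have -> : rho R m.+1 - rhoJ R (n := m.+1) J =
   2^-1 *: \sum_(a <- pos_roots R m.+1) (if root_coef (n := m.+1) i a == 0 then 0
     else a).
  rewrite /rho /rhoJ -scalerBr pos_rootsJE; congr (_ *: _).
  rewrite [in RHS](eq_bigr (fun a =>
    a - (if root_coef (n := m.+1) i a == 0 then a else 0))); last first.
    by move=> a _; case: ifP => _; rewrite ?subrr ?subr0.
  by rewrite sumrB [X in _ - X = _]big_filter [X in _ - X = _]big_mkcond.
rewrite dotZr mulrA mulfV ?pnatr_eq0 // mul1r dot_sumr sum_pos_roots //.
rewrite (eq_bigr (fun p : D * D => if l p.1 + l p.2 == 0 then 0 else
   (pairing x y p.1)%:~R + (pairing x y p.2)%:~R)); last first.
  move=> p _; rewrite root_coef_root // mulf_eq0 invr_eq0 (negPf (weight_den_neq0 _ _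
    _)) intr_eq0 /=.
  by case: ifP => _; rewrite ?dot0r // dotDr !(dotC (_ + _)) !dot_eps_root.
rewrite (eq_bigr (fun p : D * D => if l p.1 + l p.2 != 0 then
   (pairing x y p.1)%:~R + (pairing x y p.2)%:~R else 0)); last by move=> p _;
     rewrite if_neg.
rewrite -big_mkcondr /=.
rewrite (eq_bigl (fun p : D * D => (p.1.1 < p.2.1)%N && (0 < l p.1 + l p.2)));
  last first.
  move=> p; rewrite -andbA; case: ltnP => // lt12 /=; apply: weight_neq0E.
  exact: lt_abs_neq.
rewrite (sum_ordered (fun z t => (pairing x y z)%:~R) (P := fun z t =>
  0 < l z + l t)); last first.
  by move=> z t; rewrite addrC.
rewrite -(rmorph_sum intr) /=; congr (_%:~R).
transitivity (\sum_z pairing x y z * \sum_(t | z.1 != t.1) (0 < l z + l t)%R%:Z).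
  rewrite (eq_bigr (fun z =>
    \sum_(t | z.1 != t.1) pairing x y z * (0 < l z + l t)%R%:Z)); last first.
    by move=> z _; rewrite mulr_sumr.
  rewrite pair_big_dep /= [RHS](eq_bigr (fun p :
    D * D => if 0 < l p.1 + l p.2 then pairing x y p.1 else 0)).
    by rewrite -big_mkcondr.
  by move=> p _; case: ifP; rewrite ?mulr1 ?mulr0.
rewrite sum_pairing mulrDr -!sum_positive_roots //; try exact: weight_odd;
  try exact: weight_bound.
by rewrite [RHS]addrACA addrA.
Qed.

(** Each generator of [W_J] fixes [lambda], as [lambda] vanishes on the [alpha_j] with [j] different
    from the node. *)
Lemma weylJ_weight u : u \in weylJ R (n := m.+1) J ->
  u \in weylD m.+1 /\ forall x, l (u x) = l x.
Proof.
move=> /gen_prodgP[k [c cJ ->]]; elim/big_rec: _ => [|j w _ [wW wl]].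
  by split=> [|x]; rewrite ?perm1 //; apply: (group1 (Group (weylD_group m))).
have /refl_simpleP -/(_ m_gt0)[k' k'J ->] := cJ j.
have km : (k' <= m)%N := ltn_ord k'.
split; first by apply: (groupM (G := Group (weylD_group m))) => //;
  apply: srefl_weylD; apply: simple_abs.
move=> x; rewrite (permM (srefl _ _)) wl (oddf_srefl _ (@weight_odd m i)) ?simple_abs
  //.
rewrite weight_simple //; last by exact: ltn_ord i.
by move: k'J; rewrite !inE eq_sym => /negPf; rewrite -val_eqE /= => ->;
  rewrite mul0rz subr0.
Qed.

(** Products compose from left to right, so the usual [w^-1 v] is [v * w^-1] here. *)
Lemma in_cosetJ w v : (v \in cosetJ R (n := m.+1) J w) =
  (v * w^-1 \in weylJ R (n := m.+1) J)%g.
Proof.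
apply/imsetP/idP => [[u uJ ->]|vJ]; first by rewrite /wcomp mulgK.
by exists (v * w^-1)%g => //; rewrite /wcomp mulgKV.
Qed.

Lemma cosetJ_refl w : w \in cosetJ R (n := m.+1) J w.
Proof. by rewrite in_cosetJ mulgV group1. Qed.

(** [l (w^-1 z)] is the coordinate of [w lambda] along [eps z]; it does not change within a coset
    because [W_J] fixes [lambda]. *)
Lemma floorJ_spec w : w \in weylD m.+1 ->
  floorJ R (n := m.+1) J w \in min_reps R (n := m.+1) J /\
  forall z, l ((floorJ R (n := m.+1) J w)^-1%g z) = l (w^-1%g z).
Proof.
move=> wW; rewrite /floorJ; case: arg_minnP => [|v vJ vmin]; first exact: cosetJ_refl.
have [uW ul] := weylJ_weight (etrans (esym (in_cosetJ _ _)) vJ).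
rewrite in_cosetJ in vJ.
have vW : v \in weylD m.+1.
  by rewrite -(mulgKV w v); apply: (groupM (G := Group (weylD_group m))).
split=> [|z].
  rewrite inE vW; apply/forall_inP => v' v'J; apply: vmin.
  move: v'J; rewrite !in_cosetJ => v'J.
  by have := groupM v'J vJ; rewrite mulgA mulgKV.
by have := ul (v^-1%g z); rewrite permM permKV => ->.
Qed.

Lemma min_reps_weylD w : w \in min_reps R (n := m.+1) J -> w \in weylD m.+1.
Proof. by rewrite inE => /andP[]. Qed.

(** A root of [Delta_J^+] is a nonnegative combination of simple roots of [J]. If one of these had a
    negative image, composing with its reflection would give a shorter element of the same coset. *)
Lemma min_reps_gt0 w x y : w \in min_reps R (n := m.+1) J -> x.1 != y.1 ->
  0 < height x + height y -> l x + l y = 0 -> 0 < height (w x) + height (w y).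
Proof.
rewrite inE => /andP[wW /forall_inP wmin] ne hpos lxy.
have [sw _] := (weylDE w).1 wW.
have go : oddf (fun z => height (w z)) by move=> z; rewrite sw height_odd.
rewrite lt_neqAle eq_sym height_neq0 ?abs_signed //= -(ler0z R) (oddf_root R m_gt0 x
  y go).
apply: sumr_ge0 => j _; have [->|ji] := eqVneq j i; first by rewrite lxy mulr0 mul0r.
apply: mulr_ge0.
  by rewrite mulr_ge0 ?invr_ge0 ?ler0n // ler0z weight_ge0 ?height_simple ?simple_abs.
have jm : (j <= m)%N := ltn_ord j.
rewrite ler0z leNgt; apply/negP => des.
have := inversions_srefl (simple_abs m_gt0 jm) (height_simple m_gt0 jm) sw.
rewrite des [0 < _](_ : _ = false); last by apply/negbTE; rewrite -leNgt ltW.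
set r := srefl _ _.
have rJ : r \in weylJ R (n := m.+1) J.
  by apply: mem_gen; apply/refl_simpleP => //; exists j; rewrite ?inE.
have rwW : (r * w)%g \in weylD m.+1.
  by apply: (groupM (G := Group (weylD_group m))) => //; have [] := weylJ_weight rJ.
have := wmin (r * w)%g; rewrite in_cosetJ mulgK => /(_ rJ).
rewrite -leq_double !ell_inversions // => le1 e.
by move: le1; rewrite -(leq_add2r 2) e /= addn0 addn2 ltnNge leqnSn.
Qed.

End MaximalParabolic.

Definition weight_inversions (l : D -> int) : {set D * D} :=
  [set p | [&& p.1.1 != p.2.1, 0 < height p.1 + height p.2 & l p.1 + l p.2 < 0]].

(* -w maps inversions w onto the positive roots on which w lambda is negative.  *)
Lemma inversions_weight (i : 'I_m.+1) w : w \in min_reps R (n := m.+1) [set~ i] ->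
  #|inversions w| = #|weight_inversions (fun z => weight i (w^-1%g z))|.
Proof.
move=> wJ; have wW := min_reps_weylD wJ; have [sw _] := (weylDE w).1 wW.
pose f (p : D * D) := (bar (w p.1), bar (w p.2)).
have f_bij : bijective f.
  exists (fun p => (w^-1%g (bar p.1), w^-1%g (bar p.2))) => -[x y];
    rewrite /f /= ?barK ?permK //.
  by rewrite !permKV !barK.
rewrite -[RHS](on_card_preimset (f := f)); last exact: onW_bij.
apply: eq_card => -[x y];
  rewrite [RHS]inE in_inversions [in RHS]inE /f /= abs_signed //.
have [//|ne] := boolP (x.1 == y.1).
have wb t : w^-1%g (bar (w t)) = bar t by rewrite -sw permK.
rewrite !wb !height_odd !weight_odd -!opprD oppr_gt0 oppr_lt0 /= andbC.
case: (ltP _ 0) => //= hneg.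
rewrite -weight_neq0E //; case: (ltP 0 _) => //= hpos; apply/esym/eqP=> l0.
by have := min_reps_gt0 wJ ne hpos l0; rewrite ltNge ltW.
Qed.

(** The factor 2 comes from counting every root in both orders. *)
Lemma edge_eqE (i : 'I_m.+1) x y w v : x.1 != y.1 ->
  w \in min_reps R (n := m.+1) [set~ i] -> v \in min_reps R (n := m.+1) [set~ i] ->
  edge_eq (n := m.+1) [set~ i] true w (eps R x + eps R y) v <->
  #|weight_inversions (fun z => weight i (w^-1%g z))|%:Z
   - #|weight_inversions (fun z => weight i (v^-1%g z))|%:Z
  = 2 * ((m.+1.*2%:Z - abs_sum (weight i) - 1) * (weight i x + weight i y) - 1).
Proof.
move=> ne wJ vJ; rewrite -!inversions_weight // -!(ell_inversions R) ?(min_reps_weylD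
  (i := i)) //.
rewrite /edge_eq coroot_root // mulr1 dot_rho //.
set c : int := (_ - abs_sum _ - 1) * _; rewrite -!(muln2 (ell R _)) !PoszM.
have -> : (ell R v)%:R - (ell R w)%:R = ((ell R v)%:Z - (ell R w)%:Z)%:~R :> R.
  by rewrite rmorphB /= -!pmulrn.
have -> : 1 - c%:~R = (1 - c)%:~R :> R by rewrite rmorphB.
by split=> [/intr_inj|h]; last congr (_%:~R); lia.
Qed.

End Parabolic.

(** * Inversions of sign vectors *)

Section SignVectors.
Variable m : nat.
Local Notation D := (Dn m.+1).
Local Notation I := 'I_m.+1.
Implicit Types (a b : I -> int) (p q r s t : I).

(* For s < t, neg_count (a s) (a t) counts the roots eps_s +- eps_t that are    *)
(* negative on a.                                                              *)
Definition neg_count (x y : int) : int := (x + y < 0)%R%:Z + (x - y < 0)%R%:Z.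

Definition neg_pair a s t : int :=
  if (s < t)%N then neg_count (a s) (a t) else neg_count (a t) (a s).

Definition neg_total a : int := \sum_s \sum_(t | t != s) neg_pair a s t.

Lemma neg_pairC a s t : s != t -> neg_pair a s t = neg_pair a t s.
Proof.
by rewrite /neg_pair -val_eqE /=; case: ltngtP.
Qed.

(** Two distinct positions carry four sign choices, of which two are positive roots: those where the
    earlier position is unbarred. *)
Lemma weight_inversionsE (l : D -> int) : oddf l ->
  #|weight_inversions l|%:Z = neg_total (fun s => l (s, false)).
Proof.
move=> lo; rewrite -sum1_card (big_morph Posz PoszD (erefl 0%:Z)).
rewrite (eq_bigl (fun p : D * D => (p.2.1 != p.1.1) &&
   ((0 < height p.1 + height p.2) && (l p.1 + l p.2 < 0)))) => [|[x y]]; last first.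
  by rewrite inE eq_sym.
rewrite big_mkcondr /=.
rewrite -(pair_big_dep xpredT (fun x y : D => y.1 != x.1)
  (fun x y : D => if (0 < height x + height y) && (l x + l y < 0) then 1%:Z else 0)) /=.
rewrite (sum_letters xpredT) /neg_total; apply: eq_bigr => s _.
rewrite !(sum_letters (fun t => t != s)) -big_split /=; apply: eq_bigr => t ts.
have lN u : l (u, true) = - l (u, false) by rewrite -lo.
have st : s != t by rewrite eq_sym.
rewrite !height_gt0 //= !lN /neg_pair /neg_count.
case: ltnP => _ /=; rewrite ?add0r ?addr0.
  by case: (_ < 0); case: (_ < 0).
by rewrite [l (t, _) + _]addrC [l (t, _) - _]addrC; case: (_ < 0); case: (_ < 0).
Qed.

(** Isolates the pairs that meet [p] or [q]; the last sum is unaffected when only these two entries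
    change. *)
Lemma neg_total_split a p q : p != q ->
  neg_total a = 2 * (neg_pair a p q
     + \sum_(r | (r != p) && (r != q)) (neg_pair a p r + neg_pair a q r))
   + \sum_(s | (s != p) && (s != q)) \sum_(t | [&& t != s,
     t != p & t != q]) neg_pair a s t.
Proof.
move=> pq; rewrite /neg_total (bigD1 p) //= (bigD1 q) 1?eq_sym //=.
rewrite [\sum_(t | t != p) _](bigD1 q) 1?eq_sym //= [\sum_(t | t != q) _](bigD1 p) //=.
rewrite [X in _ + (_ + X) = _](eq_bigr (fun s => (neg_pair a p s + neg_pair a q s) +
   \sum_(t | [&& t != s, t != p & t != q]) neg_pair a s t)); last first.
  move=> s /andP[sp sq]; rewrite (bigD1 p) 1?eq_sym //= (bigD1 q) 1?eq_sym //=;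
    last first.
    by rewrite ![q == _]eq_sym sq pq.
  rewrite addrA (neg_pairC _ sp) (neg_pairC _ sq); congr (_ + _).
  by apply: eq_bigl => t; rewrite -andbA.
rewrite big_split /= (neg_pairC _ pq) [\sum_(i | (i != q) && (i != p)) _](eq_bigl
  (fun r => (r != p) && (r != q))); last first.
  by move=> r; rewrite andbC.
rewrite big_split /= mulr2n; set A := neg_pair _ _ _;
  set B := \sum_(_ | _) neg_pair a p _.
set C := \sum_(_ | _) neg_pair a q _; set E := \sum_(_ | _) \sum_(_ | _) _.
by lia.
Qed.

(** The gaps [1 - x] and [e r - d r] are nonnegative and add up to 0, so each of them vanishes. *)
Lemma sum_eq_bound (P : pred I) (d e : I -> int) (x : int) :
  (forall r, P r -> d r <= e r) -> x <= 1 ->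
  x + \sum_(r | P r) d r = \sum_(r | P r) e r + 1 <-> x = 1 /\ forall r, P r ->
    d r = e r.
Proof.
move=> de x1; have le_de : \sum_(r | P r) d r <= \sum_(r | P r) e r by apply: ler_sum.
split=> [E|[-> E]]; last by rewrite (eq_bigr e E) addrC.
have [-> ede] : x = 1 /\ \sum_(r | P r) (e r - d r) = 0.
  rewrite sumrB; move: E le_de;
    move: (\sum_(r | P r) e r) (\sum_(r | P r) d r) => A B E le_de.
  by split; lia.
split=> // r Pr; move/eqP: ede; rewrite psumr_eq0 => [/allP/(_ r)|s Ps]; last first.
  by rewrite subr_ge0 de.
by rewrite mem_index_enum Pr subr_eq0 => /(_ isT)/eqP.
Qed.

Section Change.
Variables (a b : I -> int) (p q : I).
Hypotheses (pq : p != q) (ab : forall r, r != p -> r != q -> a r = b r).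
Hypothesis (a_le1 : forall r, `|a r| <= 1).

Let d r := neg_pair a p r + neg_pair a q r - (neg_pair b p r + neg_pair b q r).
Let off r := (r != p) && (r != q).

Lemma neg_total_diff : neg_total a - neg_total b =
  2 * ((neg_pair a p q - neg_pair b p q) + \sum_(r | off r) d r).
Proof.
rewrite !(neg_total_split _ pq) /d sumrB.
rewrite [X in _ + X - _](eq_bigr (fun s => \sum_(t | [&& t != s,
  t != p & t != q]) neg_pair b s t)).
  by rewrite opprD addrACA subrr addr0 -mulrBr opprD addrACA.
move=> s /andP[sp sq]; apply: eq_bigr => t /and3P[_ tp tq].
by rewrite /neg_pair !ab.
Qed.

(* A nonzero entry is moved from p to q. Every other position r contributes at *)
(* most 2 - |a r| to the decrease of the number of inversions, and the pair    *)
(* (p, q) itself at most 1.                                                    *)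
Lemma neg_total_move : a q = 0 -> b p = 0 -> `|a p| = 1 -> `|b q| = 1 ->
  (exists2 z, z != q & a z = 0) ->
  neg_total a - neg_total b = 2 * (\sum_(r | off r) (2 - `|a r|) + 1) <->
  [/\ a p = -1, b q = 1, minn p q = 0%N,
      forall r, (p < r < q)%N -> a r = -1
    & forall r, (q < r < p)%N -> a r = 1].
Proof.
move=> aq bp ap bq [z zq az].
have zp : z != p by apply: contra_eq_neq ap => <-; rewrite az.
rewrite neg_total_diff.
have H : (2 * ((neg_pair a p q - neg_pair b p q) + \sum_(r | off r) d r)
   = 2 * (\sum_(r | off r) (2 - `|a r|) + 1)) <->
   (neg_pair a p q - neg_pair b p q) + \sum_(r | off r) d r =
     \sum_(r | off r) (2 - `|a r|) + 1.
  by split=> [|->] //; lia.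
rewrite {}H.
have apP : a p = 1 \/ a p = -1 by case: (int3P (a_le1 p)) ap => ->; auto.
have bq1 : `|b q| <= 1 by rewrite bq.
have bqP : b q = 1 \/ b q = -1 by case: (int3P bq1) bq => ->; auto.
have pair_le : neg_pair a p q - neg_pair b p q <= 1.
  by rewrite /neg_pair aq bp; case: apP => ->; case: bqP => ->; case: ltnP.
have d_le r : off r -> d r <= 2 - `|a r|.
  move=> /andP[rp rq]; rewrite /d /neg_pair aq bp -(ab rp rq).
  case: apP => ->; case: bqP => ->; case: (int3P (a_le1 r)) => ->;
    by case: ltnP => _; case: ltnP.
rewrite (sum_eq_bound d_le pair_le); split.
  (* The pair of [p] and [q] determines only one of the signs of [a p] and [b q]; equality at the
     further zero entry [z] determines the other. *)
  have zoff : off z by rewrite /off zp zq.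
  move=> [pair1 d_eq]; have := d_eq z zoff.
  rewrite /d /neg_pair aq bp -(ab zp zq) az.
  have [pq1|pq1] := ltnP p q.
    have ap1 : a p = -1.
      by move: pair1; rewrite /neg_pair pq1 aq bp; case: apP => ->; case: bqP => ->.
    rewrite ap1 => dz.
    have bq1' : b q = 1.
      by move: dz; case: bqP => -> //; case: ltnP => _; case: ltnP.
    split=> //.
    (* [neg_count] is even in its second argument, so a position before both [p] and [q] sees no
       difference between [a] and [b]: its contribution is 0, below its bound. *)
    - case: (posnP p) => // p0.
      have rp : ord0 != p by rewrite -val_eqE /= neq_ltn p0.
      have rq : ord0 != q by rewrite -val_eqE /= neq_ltn (ltn_trans p0 pq1).
      have := d_eq ord0; rewrite /off rp rq => /(_ isT).
      rewrite /d /neg_pair aq bp ap1 bq1' -(ab rp rq) !ltn0.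
      by case: (int3P (a_le1 ord0)) => ->.
    - move=> r /andP[pr rq]; have rp1 : r != p by rewrite -val_eqE /= (gtn_eqF pr).
      have rq1 : r != q by rewrite -val_eqE /= (ltn_eqF rq).
      have := d_eq r; rewrite /off rp1 rq1 => /(_ isT).
      rewrite /d /neg_pair aq bp ap1 bq1' -(ab rp1 rq1).
      rewrite pr ltnNge (ltnW rq) /=.
      by case: (int3P (a_le1 r)) => ->.
    - by move=> r /andP[qr rp]; have := ltn_trans (ltn_trans qr rp) pq1; rewrite ltnn.
  have qp1 : (q < p)%N by rewrite ltn_neqAle pq1 andbT eq_sym.
  have bq1' : b q = 1.
    by move: pair1; rewrite /neg_pair ltnNge pq1 /= aq bp; case: apP => ->;
      case: bqP => ->.
  rewrite bq1' => dz.
  have ap1 : a p = -1.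
    by move: dz; case: apP => -> //; case: ltnP => _; case: ltnP.
  split=> //.
  - case: (posnP q) => // p0.
    have rq : ord0 != q by rewrite -val_eqE /= neq_ltn p0.
    have rp : ord0 != p by rewrite -val_eqE /= neq_ltn (leq_trans p0 pq1).
    have := d_eq ord0; rewrite /off rp rq => /(_ isT).
    rewrite /d /neg_pair aq bp ap1 bq1' -(ab rp rq) !ltn0.
    by case: (int3P (a_le1 ord0)) => ->.
  - by move=> r /andP[pr rq]; have := ltn_trans (ltn_trans pr rq) qp1; rewrite ltnn.
  - move=> r /andP[qr rp]; have rp1 : r != p by rewrite -val_eqE /= (ltn_eqF rp).
    have rq1 : r != q by rewrite -val_eqE /= (gtn_eqF qr).
    have := d_eq r; rewrite /off rp1 rq1 => /(_ isT).
    rewrite /d /neg_pair aq bp ap1 bq1' -(ab rp1 rq1).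
    rewrite qr ltnNge (ltnW rp) /=.
    by case: (int3P (a_le1 r)) => ->.
move=> [ap1 bq1' min0 btw1 btw2]; rewrite /d /neg_pair aq bp ap1 bq1'.
have [pq1|pq1] := ltnP p q.
  split=> // r /andP[rp rq]; rewrite -(ab rp rq).
  move: min0; rewrite (minn_idPl (ltnW pq1)) => p0.
  have pr : (p < r)%N by rewrite ltn_neqAle eq_sym rp p0.
  rewrite pr; have [qr|qr] := ltnP q r; first by case: (int3P (a_le1 r)) => ->.
  by rewrite btw1 // pr ltn_neqAle rq qr.
split=> // r /andP[rp rq]; rewrite -(ab rp rq).
move: min0; rewrite (minn_idPr pq1) => q0.
have qr : (q < r)%N by rewrite ltn_neqAle eq_sym rq q0.
rewrite qr; have [pr|pr] := ltnP p r; first by case: (int3P (a_le1 r)) => ->.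
by rewrite btw2 // qr ltn_neqAle rp pr.
Qed.

(* Two entries change sign; every other position r contributes at most         *)
(* 2 * (2 - |a r|).                                                            *)
Lemma neg_total_flip : (1 < m)%N -> `|a p| = 1 -> `|a q| = 1 ->
  b p = - a p -> b q = - a q ->
  neg_total a - neg_total b = 2 * (2 * \sum_(r | off r) (2 - `|a r|) + 1) <->
  [/\ a p = -1, a q = -1 & (p < 2)%N && (q < 2)%N].
Proof.
move=> m2 ap aq bp bq; rewrite neg_total_diff mulr_sumr.
have H : (2 * ((neg_pair a p q - neg_pair b p q) + \sum_(r | off r) d r)
   = 2 * (\sum_(r | off r) 2 * (2 - `|a r|) + 1)) <->
   (neg_pair a p q - neg_pair b p q) + \sum_(r | off r) d r =
     \sum_(r | off r) 2 * (2 - `|a r|) + 1.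
  by split=> [|->] //; lia.
rewrite {}H.
have apP : a p = 1 \/ a p = -1 by case: (int3P (a_le1 p)) ap => ->; auto.
have aqP : a q = 1 \/ a q = -1 by case: (int3P (a_le1 q)) aq => ->; auto.
have pair_le : neg_pair a p q - neg_pair b p q <= 1.
  by rewrite /neg_pair bp bq; case: apP => ->; case: aqP => ->; case: ltnP.
have d_le r : off r -> d r <= 2 * (2 - `|a r|).
  move=> /andP[rp rq]; rewrite /d /neg_pair bp bq -(ab rp rq).
  case: apP => ->; case: aqP => ->; case: (int3P (a_le1 r)) => ->;
    by case: ltnP => _; case: ltnP.
have npq : (p : nat) <> q by apply/eqP; exact: pq.
rewrite (sum_eq_bound d_le pair_le); split.
  move=> [pair1 d_eq].
  (* A sign change is invisible to earlier positions, so an [r] preceding [p] or [q] can reach at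
     most half of its bound. *)
  have before r : off r -> (p < r)%N /\ (q < r)%N.
    move=> ofr; have := d_eq r ofr; have /andP[rp rq] := ofr.
    have nrp : (r : nat) <> p by apply/eqP; exact: rp.
    have nrq : (r : nat) <> q by apply/eqP; exact: rq.
    rewrite /d /neg_pair bp bq -(ab rp rq).
    case: (ltnP p r) => pr; case: (ltnP q r) => qr //;
    by case: apP => ->; case: aqP => ->; case: (int3P (a_le1 r)) => ->.
  have lt2 (u : I) : (u == p) || (u == q) -> (u < 2)%N.
    move=> upq; rewrite ltnNge; apply/negP => u2.
    (* As [u] is [p] or [q] and is at least 2, one of the positions 0 and 1 is neither [p] nor
       [q]. *)
    have [r ru ofr] : exists2 r : I, (r < u)%N & off r.
      have o1 : (0 < m.+1)%N by []. have o2 : (1 < m.+1)%N by lia.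
      move: upq => /orP[]/eqP eu; subst u.
        have [q0|q0] := eqVneq (q : nat) 0%N.
          exists (Ordinal o2) => //; rewrite /off -!val_eqE /=; lia.
        exists (Ordinal o1); rewrite /off -?val_eqE /=; lia.
      have [q0|q0] := eqVneq (p : nat) 0%N.
        exists (Ordinal o2) => //; rewrite /off -!val_eqE /=; lia.
      exists (Ordinal o1); rewrite /off -?val_eqE /=; lia.
    have [pr qr] := before r ofr.
    by move: upq ru => /orP[]/eqP ->; rewrite ltnNge ltnW.
  have p2 := lt2 p; have q2 := lt2 q; rewrite !eqxx orbT in p2 q2.
  have p2' := p2 isT; have q2' := q2 isT.
  (* Position 2 comes after both [p] and [q]; equality there forces the two signs. *)
  have o3 : (2 < m.+1)%N by [].
  have of2 : off (Ordinal o3) by rewrite /off -!val_eqE /= !neq_ltn p2' q2' !orbT.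
  have := d_eq _ of2; have /andP[rp rq] := of2.
  rewrite /d /neg_pair bp bq -(ab rp rq) p2' q2'.
  by case: apP => ->; case: aqP => ->; case: (int3P (a_le1 (Ordinal o3))) => ->.
move=> [ap1 aq1 /andP[p2 q2]]; split.
  by rewrite /neg_pair bp bq ap1 aq1; case: ltnP.
move=> r /andP[rp rq].
have nrp : (r : nat) <> p by apply/eqP; exact: rp.
have nrq : (r : nat) <> q by apply/eqP; exact: rq.
have [pr qr] : (p < r)%N /\ (q < r)%N by lia.
rewrite /d /neg_pair bp bq -(ab rp rq) ap1 aq1 pr qr.
by case: (int3P (a_le1 r)) => ->.
Qed.

End Change.
End SignVectors.

(** * Minimal representatives as increasing columns *)

Section Columns.
Variables (R : realFieldType) (m : nat) (m_gt2 : (2 < m)%N) (i : 'I_m.+1).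
Local Notation D := (Dn m.+1).
Local Notation l := (weight (m := m) i).
Local Notation J := [set~ i].
Implicit Types (x y z : D) (w u v : {perm D}) (s t : nat).

Let m_gt0 : (0 < m)%N. Proof. exact: ltn_trans m_gt2. Qed.

(* The letters b_1, ..., b_k (indexed from 0) for which the multiple of omega_i *)
(* in the definition of weight is the sum of the eps b_s. They are 1, ..., i,   *)
(* unless i = n - 1, where they are 1, ..., n - 1, \bar n.                      *)
Definition chain s : D :=
  if (i.+1 == m) && (s == m) then bar (letter m.+1 s.+1) else letter m.+1 s.+1.

Definition chain_size : nat := if (i.+1 < m)%N then i.+1 else m.+1.

Lemma chain_size_le : (chain_size <= m.+1)%N.
Proof. by rewrite /chain_size; case: ifP => [/ltnW/ltnW|]. Qed.

Lemma chain_abs s : (s <= m)%N -> (chain s).1 = s :> nat.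
Proof. by move=> sm; rewrite /chain; case: ifP => _ /=; rewrite idxK. Qed.

Lemma height_chain s : (s <= m)%N -> height (chain s) = (m - s)%N.
Proof.
move=> sm; rewrite /height chain_abs // /chain;
  case: (boolP (_ && _)) => [/andP[_ /eqP ->]|_] /=.
  by rewrite subnn.
by [].
Qed.

Lemma weight_chain s : (s < chain_size)%N -> l (chain s) = 1.
Proof.
move=> sk; have sm : (s <= m)%N by rewrite -ltnS (leq_trans sk chain_size_le).
have im : (i <= m)%N := ltn_ord i.
move: sk; rewrite /weight chain_abs // /chain /chain_size.
case: (ltngtP i.+1 m) => // im1; try by rewrite /= ltnS => ->.
by case: eqP.
Qed.

Lemma weight_chainP z : reflect (exists2 s,
  (s < chain_size)%N & z = chain s) (l z == 1).
Proof.
apply: (iffP eqP) => [lz|[s sk ->]]; last exact: weight_chain.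
have zm : (z.1 <= m)%N := ltn_ord z.1.
have im : (i <= m)%N := ltn_ord i.
exists (nat_of_ord z.1).
  rewrite /chain_size; case: ifP => // im1; move: lz; rewrite /weight im1.
  by rewrite ltnS; case: z.2; case: leqP.
apply/eqP; rewrite letter_eqE -val_eqE /= chain_abs // eqxx /=.
move: lz; rewrite /weight /chain.
case: (ltngtP i.+1 m) => // im1 /=; first by case: z.2; case: leqP.
  by case: z.2.
by case: eqP => _; case: z.2.
Qed.

Lemma abs_sum_weight : abs_sum l = chain_size.
Proof.
rewrite /abs_sum /weight /chain_size /=; case: ifP => im.
  rewrite (eq_bigr (fun s : 'I_m.+1 => (if (s < i.+1)%N then 1 else 0))) => [|s _];
    last first.
    by rewrite ltnS; case: leqP.
  rewrite -big_mkcond /= (big_ord_narrow (ltn_ord i :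
    (i.+1 <= m.+1)%N)) sumr_const card_ord.
  by rewrite natz.
rewrite (eq_bigr (fun=> 1)) => [|s _]; last by case: ifP.
by rewrite sumr_const card_ord natz.
Qed.

Lemma abs_sum_signed (g : D -> int) u : oddf g -> signed u ->
  abs_sum (fun z => g (u z)) = abs_sum g.
Proof.
move=> go su; rewrite [RHS](reindex_inj (abs_inj su)); apply: eq_bigr => s _ /=.
by case: (u _) => t [] //=; rewrite -[(t, true)]/(bar (t, false)) go normrN.
Qed.

(** The one-column tableau of the coset of [w]: its letters are those along which [w lambda] has
    coordinate 1. *)
Definition column w : seq D := [seq w (chain s) | s <- iota 0 chain_size].

(** The order in which 1 comes first and [\bar 1] last; n and [\bar n] have the same height and are
    not comparable. *)
Definition higher : rel D := [rel x y | height y < height x].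

Lemma higher_trans : transitive higher.
Proof. by move=> y x z; rewrite /= => xy yz; apply: lt_trans yz xy. Qed.

Lemma higher_irr : irreflexive higher.
Proof. by move=> x; rewrite /higher /= ltxx. Qed.

(** For [s < t], the root [eps (chain s) - eps (chain t)] is positive and [lambda] vanishes on it,
    so a minimal representative keeps it positive. *)
Lemma column_sorted w : w \in min_reps R (n := m.+1) J -> sorted higher (column w).
Proof.
move=> wJ; have wW := min_reps_weylD wJ; have [sw _] := (weylDE w).1 wW.
rewrite /column sorted_map.
have all_iota : all (fun s => s < chain_size)%N (iota 0 chain_size).
  by apply/allP=> s; rewrite mem_iota.
apply: (sub_in_sorted _ all_iota (iota_ltn_sorted _ _)) => s t sk tk /= st.
rewrite unfold_in in sk; rewrite unfold_in in tk.
have [sm tm] : (s <= m)%N /\ (t <= m)%N by have := chain_size_le; lia.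
have ne : (chain s).1 != (bar (chain t)).1.
  by rewrite -val_eqE /= !chain_abs // neq_ltn st.
have := min_reps_gt0 m_gt0 wJ ne;
  rewrite sw !height_odd weight_odd !weight_chain // !height_chain //.
by rewrite !subr_gt0 subrr => H; apply: H => //; move: st tm; clear; lia.
Qed.

Lemma mem_column w z : (z \in column w) = (l (w^-1%g z) == 1).
Proof.
apply/mapP/weight_chainP => [[s]|[s sk e]].
  by rewrite mem_iota add0n => sk ->; exists s; rewrite ?permK.
by exists s; rewrite ?mem_iota // -e permKV.
Qed.

Lemma size_column w : size (column w) = chain_size.
Proof. by rewrite size_map size_iota. Qed.

Lemma nth_column w s x0 : (s < chain_size)%N -> nth x0 (column w) s = w (chain s).
Proof. by move=> sk; rewrite (nth_map 0%N) ?size_iota // nth_iota. Qed.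

Lemma column_eq w (S : seq D) : w \in min_reps R (n := m.+1) J ->
  sorted higher S -> (forall z, (l (w^-1%g z) == 1) = (z \in S)) -> column w = S.
Proof.
move=> wJ Ss e; apply: (irr_sorted_eq higher_trans higher_irr (column_sorted wJ) Ss)
  => z.
by rewrite mem_column e.
Qed.

Lemma sorted_higher_cons z (S : seq D) : (forall x, x \in S -> height x < height z) ->
  sorted higher S -> sorted higher (z :: S).
Proof.
by move=> zS; rewrite /= (path_sortedE higher_trans) => ->; rewrite andbT; apply/allP.
Qed.

Lemma sorted_higher_rcons z (S : seq D) : (forall x, x \in S -> height z < height x) ->
  sorted higher S -> sorted higher (rcons S z).
Proof.
case: S => // x S zS; rewrite /= rcons_path => -> /=; apply: zS; exact: mem_last.
Qed.

End Columns.

(** * Quantum edges *)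

Section SmallLetters.
Variable m : nat.
Hypothesis m_gt0 : (0 < m)%N.

Lemma eq_letter (z : Dn m.+1) (t : nat) : (t <= m)%N ->
  (z == letter m.+1 t.+1) = (z.1 == t :> nat) && ~~ z.2.
Proof. by move=> tm; rewrite letter_eqE -val_eqE /= idxK //= eqbF_neg. Qed.

Lemma eq_bar_letter (z : Dn m.+1) (t : nat) : (t <= m)%N ->
  (z == bar (letter m.+1 t.+1)) = (z.1 == t :> nat) && z.2.
Proof. by move=> tm; rewrite letter_eqE -val_eqE /= idxK //= eqb_id. Qed.

Lemma height_lt (s t : 'I_m.+1) c :
  (@height m (s, c) < @height m (t, c)) = if c then (s < t)%N else (t < s)%N.
Proof.
have := ltn_ord s; have := ltn_ord t; rewrite /height /=.
by case: c; move: (nat_of_ord s) (nat_of_ord t) => S T; clear; lia.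
Qed.

End SmallLetters.

Lemma weight_eq0 m i (z : Dn m.+1) : (i.+1 < m)%N -> (i < z.1)%N -> weight i z = 0.
Proof. by move=> im iz; rewrite /weight im leqNgt iz /=; case: z.2. Qed.

Lemma weight_eq0P m i (z : Dn m.+1) : weight i z = 0 -> (i.+1 < m)%N /\ (i < z.1)%N.
Proof.
rewrite /weight; case: (i.+1 < m)%N => /=; last by case: z.2; case: (_ && _).
by case: ltnP => //; case: z.2.
Qed.

(** Evaluates [a_ 1] and [a_ 2]: nothing between 1 and [M.+1] is free. *)
Lemma filter_iota2 (P : pred nat) n M : (0 < M < n)%N -> P 1%N -> P M.+1 ->
  (forall r, (0 < r < M)%N -> ~~ P r.+1) ->
  nth 0%N [seq s <- iota 1 n | P s] 0 = 1%N /\ nth 0%N [seq s <- iota 1 n | P s] 1 =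
    M.+1.
Proof.
move=> /andP[M0 Mn] P1 PM btw.
have -> : iota 1 n = 1%N :: iota 2 M.-1 ++ M.+1 :: iota M.+2 (n - M.+1).
  have -> : n = (1 + (M.-1 + (1 + (n - M.+1))))%N by lia.
  rewrite iotaD iotaD iotaD /=; congr (_ :: _ ++ _ :: iota _ _); lia.
rewrite /= P1 filter_cat /= PM.
rewrite (_ : [seq s <- iota 2 M.-1 | P s] = [::]) //.
rewrite -(filter_pred0 (iota 2 M.-1)); apply/eq_in_filter => -[|r]; rewrite mem_iota //.
by move=> /andP[r1 r2]; apply/negbTE/btw; lia.
Qed.

(** * The edge equation in terms of the entries of [w lambda] and [v lambda] *)

Section Edge.
Variables (R : realFieldType) (m : nat) (m_gt2 : (2 < m)%N) (i : 'I_m.+1).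
Local Notation D := (Dn m.+1).
Local Notation l := (weight (m := m) i).
Local Notation J := [set~ i].
Local Notation k := (chain_size i).
Local Notation L1 := (letter m.+1 1).
Local Notation L2 := (letter m.+1 2).

Let m_gt0 : (0 < m)%N. Proof. exact: ltn_trans m_gt2. Qed.

Variables (x y : D) (w v : {perm D}).
Hypotheses (ne : x.1 != y.1)
  (wJ : w \in min_reps R (n := m.+1) J) (vJ : v \in min_reps R (n := m.+1) J).

Local Notation lw := (fun z => l (w^-1%g z)).
Local Notation lv := (fun z => l (v^-1%g z)).

(** [v lambda] is the image of [w lambda] under the reflection of root [w gamma]; [a] and [b] below
    are the coordinates of [w lambda] and [v lambda]. *)
Hypothesis lvE : forall z, lv z = lw z - (l x + l y) * pairing (w x) (w y) z.

Let w_signed : signed w. Proof. by have [] := (weylDE w).1 (min_reps_weylD wJ). Qed.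
Let v_signed : signed v. Proof. by have [] := (weylDE v).1 (min_reps_weylD vJ). Qed.
Let lw_odd : oddf lw. Proof. by move=> z; rewrite signedV // weight_odd. Qed.
Let lv_odd : oddf lv. Proof. by move=> z; rewrite signedV // weight_odd. Qed.
Let lw_bound z : `|lw z| <= 1. Proof. exact: weight_bound. Qed.
Let lwx : lw (w x) = l x. Proof. by rewrite /= permK. Qed.
Let lwy : lw (w y) = l y. Proof. by rewrite /= permK. Qed.
Let neXY : (w x).1 != (w y).1. Proof. by rewrite abs_signed. Qed.
Let a (r : 'I_m.+1) := lw (r, false).
Let b (r : 'I_m.+1) := lv (r, false).

Lemma entry_abs (g : D -> int) z : oddf g ->
  g (z.1, false) = if z.2 then - g z else g z.
Proof. by move=> go; case: z => s [] //=; rewrite -go. Qed.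

Let aX : a (w x).1 = if (w x).2 then - l x else l x.
Proof. by rewrite /a (entry_abs _ lw_odd) lwx. Qed.
Let aY : a (w y).1 = if (w y).2 then - l y else l y.
Proof. by rewrite /a (entry_abs _ lw_odd) lwy. Qed.

Let bX : b (w x).1 = if (w x).2 then l y else - l y.
Proof.
rewrite /b (entry_abs _ lv_odd) lvE lwx /pairing.
have [nxy _ nxby _] := abs_neqE neXY.
by rewrite eqxx nxy nxby eq_bar_self /=; case: (w x).2; lia.
Qed.
Let bY : b (w y).1 = if (w y).2 then l x else - l x.
Proof.
rewrite /b (entry_abs _ lv_odd) lvE lwy /pairing.
have [_ nyx _ nybx] := abs_neqE neXY.
by rewrite eqxx nyx nybx eq_bar_self /=; case: (w y).2; lia.
Qed.

Let ab r : r != (w x).1 -> r != (w y).1 -> a r = b r.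
Proof.
move=> rX rY; rewrite /a /b lvE /pairing.
have E z : r != z.1 -> ((r, false) == z) = false /\ ((r, false) == bar z) = false.
  by move=> rz; rewrite !letter_eqE /= (negPf rz).
have [-> ->] := E _ rX; have [-> ->] := E _ rY; lia.
Qed.

(** Total of the bounds [2 - |a r|] over the unchanged positions. *)
Let off_sum : \sum_(r | (r != (w x).1) && (r != (w y).1)) (2 - `|a r|) =
  m.+1.*2%:Z - k%:Z - (2 - `|l x|) - (2 - `|l y|).
Proof.
have -> : m.+1.*2%:Z - k%:Z = \sum_(r : 'I_m.+1) (2 - `|a r|).
  rewrite sumrB sumr_const card_ord -(abs_sum_weight i).
  rewrite -(abs_sum_signed (weight_odd i) (signedV w_signed)) /abs_sum.
  rewrite -mul2n PoszM -[2 *+ _]mulr_natr; congr (_ * _ - _); exact: (esym (natz _)).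
rewrite [in RHS](bigD1 (w x).1) // (bigD1 (w y).1) /=; last by rewrite eq_sym.
rewrite aX aY; set A := \sum_(_ | _) _; case: (w x).2; case: (w y).2;
  rewrite ?normrN; lia.
Qed.

Let edgeE : edge_eq (n := m.+1) J true w (eps R x + eps R y) v <->
  neg_total a - neg_total b = 2 * ((m.+1.*2%:Z - k%:Z - 1) * (l x + l y) - 1).
Proof.
rewrite (edge_eqE m_gt0 ne wJ vJ) !weight_inversionsE //.
by rewrite abs_sum_weight.
Qed.

(** * Edges that change the sign of two entries *)

Section Flip.
Hypotheses (lx1 : l x = 1) (ly1 : l y = 1).

Lemma flip_edgeE : edge_eq (n := m.+1) J true w (eps R x + eps R y) v <->
  [/\ (w x).2, (w y).2, ((w x).1 < 2)%N & ((w y).1 < 2)%N].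
Proof.
have ap1 : `|a (w x).1| = 1 by rewrite aX lx1; case: ifP.
have aq1 : `|a (w y).1| = 1 by rewrite aY ly1; case: ifP.
have bp : b (w x).1 = - a (w x).1 by rewrite aX bX lx1 ly1; case: ifP.
have bq : b (w y).1 = - a (w y).1 by rewrite aY bY lx1 ly1; case: ifP.
have := neg_total_flip neXY ab (fun r => lw_bound (r,
  false)) (ltn_trans _ m_gt2) ap1 aq1 bp bq.
rewrite off_sum edgeE lx1 ly1 => /(_ isT) H.
(* Since [2 (2n - k - 1) - 1 = 2 (2n - k - 2) + 1], the edge equation is exactly the extremal case
   of [neg_total_flip]. *)
rewrite (_ : 2 * _ = 2 * (2 * (m.+1.*2%:Z - k%:Z - (2 - `|1|) - (2 - `|1|)) + 1));
  last lia.
rewrite H aX aY lx1 ly1.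
by case: (w x).2; case: (w y).2; split=> // -[] // _ _; [move=> /andP[] | move=> -> ->].
Qed.

End Flip.

Section FlipColumns.
Hypotheses (lx1 : l x = 1) (ly1 : l y = 1).
Hypotheses (wx : w x = bar L2) (wy : w y = bar L1).

(** The letters [\bar 2], [\bar 1] are the lowest ones and 1, 2 the highest ones; the other letters
    lie strictly between and keep their order. *)
Lemma flip_columns : exists S : seq D,
  column i w = rcons (rcons S (bar L2)) (bar L1) /\ column i v = L1 :: L2 :: S.
Proof.
have m2 : (1 <= m)%N := m_gt0.
have lwL1 : lw L1 = -1 by rewrite -[L1]barK lw_odd -wy lwy ly1.
have lwL2 : lw L2 = -1 by rewrite -[L2]barK lw_odd -wx lwx lx1.
have lwbL1 : lw (bar L1) = 1 by rewrite lw_odd lwL1.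
have lwbL2 : lw (bar L2) = 1 by rewrite lw_odd lwL2.
have L12 : L1.1 != L2.1 by rewrite -[L1.1]/((bar L1).1) -[L2.1]/((bar L2).1) -wx -wy
  eq_sym.
have [n12 n21 n1b2 n2b1] := abs_neqE L12.
pose S := [seq z <- column i w | (z != bar L1) && (z != bar L2)].
have memS z : (z \in S) = [&& z != bar L1, z != bar L2 & lw z == 1].
  by rewrite mem_filter /= (mem_column m_gt2) -andbA.
have lwz z c : lw z == c -> lw z = c by move/eqP.
have sS : sorted (@higher m) S.
  by apply: (sorted_filter (@higher_trans m)); apply: (column_sorted m_gt2 wJ).
have h1 : height L1 = m by rewrite /height /= idxK // subn0.
have h2 : height L2 = (m - 1)%N by rewrite /height /= idxK.
have hS z : z \in S -> height (bar L2) < height z < height L2.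
  rewrite memS => /and3P[z1 z2 /lwz lz].
  have zL1 : z != L1 by apply: contra_eq_neq lz => ->; rewrite lwL1.
  have zL2 : z != L2 by apply: contra_eq_neq lz => ->; rewrite lwL2.
  have zm : (z.1 <= m)%N := ltn_ord z.1.
  move: zL1 zL2 z1 z2; rewrite height_odd h2 !eq_letter // !eq_bar_letter // /height.
  move: (nat_of_ord z.1) zm => t tm.
  by case: z.2 => /=; rewrite ?andbT ?andbF; move: m_gt2 tm; clear; lia.
exists S; split; [apply: (column_eq m_gt2 wJ) | apply: (column_eq m_gt2 vJ)].
- apply: sorted_higher_rcons => [z|];
  last by apply: sorted_higher_rcons => // z /hS /andP[].
  rewrite mem_rcons inE => /orP[/eqP ->|/hS /andP[hz _]].
    by rewrite !height_odd h1 h2; move: m_gt2; clear; lia.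
  by apply: lt_trans hz; rewrite !height_odd h1 h2; move: m_gt2; clear; lia.
- move=> z; rewrite mem_rcons inE mem_rcons inE memS.
  have [->|_] := eqVneq z (bar L1); first by rewrite lwbL1.
  by have [->|_] := eqVneq z (bar L2); first by rewrite lwbL2.
- apply: sorted_higher_cons => [z|];
  last by apply: sorted_higher_cons => // z /hS /andP[].
  rewrite inE => /orP[/eqP ->|/hS /andP[_ hz]].
    by rewrite h1 h2; move: m_gt2; clear; lia.
  by apply: lt_trans hz _; rewrite h1 h2; move: m_gt2; clear; lia.
move=> z; rewrite !inE memS lvE wx wy lx1 ly1 /pairing !barK.
have nb1 : (L1 == bar L1) = false by rewrite eq_bar_self.
have nb2 : (L2 == bar L2) = false by rewrite eq_bar_self.
have [->|_] := eqVneq z L1; first by rewrite nb1 n1b2 n12 lwL1.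
have [->|_] := eqVneq z L2; first by rewrite nb2 n2b1 lwL2.
have [->|_] := eqVneq z (bar L1); first by rewrite bar_eq n12 lwbL1.
have [->|_] := eqVneq z (bar L2); first by rewrite lwbL2.
by rewrite /= -[X in X == 1]/(lw z - _) mulr0 subr0.
Qed.

Lemma flip_conditions :
  [/\ (1 < k)%N, w (chain i k.-1) = bar L1 /\ w (chain i k.-2) = bar L2,
      v (chain i 0) = L1 /\ v (chain i 1) = L2,
      forall s, (1 < s < k)%N -> v (chain i s) = w (chain i (s - 2))
    & x = chain i k.-2 /\ y = chain i k.-1].
Proof.
have [S [cw cv]] := flip_columns.
have kS : k = (size S).+2 by rewrite -(size_column i w) cw !size_rcons.
have nw s : (s < k)%N -> w (chain i s) = nth L1 (rcons (rcons S (bar L2)) (bar L1)) s.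
  by move=> sk; rewrite -cw nth_column.
have nv s : (s < k)%N -> v (chain i s) = nth L1 (L1 :: L2 :: S) s.
  by move=> sk; rewrite -cv nth_column.
have wk1 : w (chain i k.-1) = bar L1.
  by rewrite nw kS //= nth_rcons size_rcons ltnn eqxx.
have wk2 : w (chain i k.-2) = bar L2.
  by rewrite nw kS ?leqnSn //= nth_rcons size_rcons ltnSn nth_rcons ltnn eqxx.
split=> //; first by rewrite kS.
- by split; rewrite nv ?kS.
- move=> s /andP[s1 sk]; rewrite nv // nw; last by apply: leq_ltn_trans sk;
  apply: leq_subr.
  case: s s1 sk => [|[|s]] // _ sk; rewrite subn2 /= !nth_rcons size_rcons.
  by rewrite kS !ltnS in sk; rewrite sk ltnS ltnW.
by split; apply: (@perm_inj _ w); rewrite ?wx ?wy ?wk1 ?wk2.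
Qed.

End FlipColumns.

(** The coordinate along [\bar 1] falls from 1 in [w lambda] to -1 in [v lambda], so [\bar 1] is
    [w x] or [w y]; likewise for [\bar 2]. *)
Lemma flip_converse : l x + l y = 2 -> w (chain i k.-1) = bar L1 ->
  w (chain i k.-2) = bar L2 ->
  (1 < k)%N -> v (chain i 0) = L1 -> v (chain i 1) = L2 ->
  (w x = bar L2 /\ w y = bar L1) \/ (w y = bar L2 /\ w x = bar L1).
Proof.
move=> lxy w1 w2 k1 v1 v2.
have inXY z s t : (s < k)%N -> (t < k)%N -> w (chain i s) = bar z ->
  v (chain i t) = z ->
    (bar z == w x) || (bar z == w y).
  move=> sk tk ws vt; have := lvE (bar z).
  rewrite lv_odd -{1}vt -ws !permK !weight_chain // lxy ws /pairing.
  by case: (bar z == w x); case: (bar z == w y); case: (_ == _); case: (_ == _).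
have m1 : (0 < m)%N := m_gt0.
have n12 : (bar L1 == bar L2) = false by rewrite eq_bar_letter // /= idxK.
have k0 := ltnW k1.
have b1 := inXY L1 k.-1 0%N (ltac:(by rewrite ltn_predL)) k0 w1 v1.
have k2 : (k.-2 < k)%N by rewrite (leq_ltn_trans (leq_pred _)) // ltn_predL.
have b2 := inXY L2 k.-2 1%N k2 k1 w2 v2.
have [e1|e1] := eqVneq (bar L1) (w x).
  right; split=> //; move: b2; rewrite -e1 eq_sym n12 => /eqP //.
move: b1; rewrite (negPf e1) => /eqP e2.
by left; split=> //; move: b2; rewrite -e2 [_ == bar L1]eq_sym n12 orbF => /eqP.
Qed.

(** * Edges that move an entry to the place of a zero *)

Section Move.
Hypotheses (lx1 : l x = 1) (ly0 : l y = 0).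

Let im : (i.+1 < m)%N. Proof. by have [] := weight_eq0P ly0. Qed.
Let kE : k = i.+1. Proof. by rewrite /chain_size im. Qed.
Let iy : (i < y.1)%N. Proof. by have [] := weight_eq0P ly0. Qed.
Local Notation p := ((w x).1 : 'I_m.+1).
Local Notation q := ((w y).1 : 'I_m.+1).

Let zero_pos (u : D) : (i < u.1)%N -> a (w u).1 = 0.
Proof.
move=> iu; rewrite /a (entry_abs _ lw_odd) /= permK weight_eq0 //.
by case: ifP; rewrite ?oppr0.
Qed.

(** The equality case of [neg_total_move]: the two bars stand for [a p = -1] and [b q = 1]. *)
Definition move_spec : Prop :=
  [/\ (w x).2, (w y).2, minn p q = 0%N,
      forall r : 'I_m.+1, (p < r < q)%N -> lw (r, false) = -1
    & forall r : 'I_m.+1, (q < r < p)%N -> lw (r, false) = 1].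

Lemma move_edgeE :
  edge_eq (n := m.+1) J true w (eps R x + eps R y) v <-> move_spec.
Proof.
have aq : a q = 0 by rewrite aY ly0 oppr0; case: ifP.
have bp : b p = 0 by rewrite bX ly0 oppr0; case: ifP.
have ap : `|a p| = 1 by rewrite aX lx1; case: ifP.
have bq : `|b q| = 1 by rewrite bY lx1; case: ifP.
(* As [lambda] vanishes at n - 1 and n, the letters [w (n-1)] and [w n] give two zero positions, at
   least one of which is not [q]. *)
have zero : exists2 z, z != q & a z = 0.
  have t1 : (letter m.+1 m).1 = m.-1 :> nat by rewrite /= idxK //; lia.
  have t2 : (letter m.+1 m.+1).1 = m :> nat by rewrite /= idxK //; lia.
  have [e|e] := eqVneq (w (letter m.+1 m)).1 q.
    exists (w (letter m.+1 m.+1)).1; last by apply: zero_pos; rewrite t2; lia.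
    by rewrite -e abs_signed // -val_eqE /= t1 t2; lia.
  by exists (w (letter m.+1 m)).1 => //; apply: zero_pos; rewrite t1; lia.
have := neg_total_move neXY ab (fun r => lw_bound (r, false)) aq bp ap bq zero.
rewrite off_sum edgeE lx1 ly0 => H.
have -> : 2 * ((m.+1.*2%:Z - k%:Z - 1) * (1 + 0) - 1) =
    2 * (m.+1.*2%:Z - k%:Z - (2 - `|1|) - (2 - `|0|) + 1) :> int.
  by rewrite normr1 normr0; lia.
rewrite H aX bY lx1 /move_spec.
by case: (w x).2; case: (w y).2; split=> E //; case: E.
Qed.

(** The forced signs between [p] and [q] make [w x] lower, and [bar (w y)] higher, than every
    remaining letter. *)
Lemma move_columns : move_spec -> exists S : seq D,
  column i w = rcons S (w x) /\ column i v = bar (w y) :: S.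
Proof.
case=> x2 y2 min0 btw1 btw2.
have Xe : w x = (p, true) by case: (w x) x2 => s [].
have Ye : bar (w y) = (q, false) by case: (w y) y2 => s [].
pose S := [seq z <- column i w | z != w x].
have memS z : (z \in S) =
  (z != w x) && (lw z == 1) by rewrite mem_filter (mem_column m_gt2).
have sS : sorted (@higher m) S.
  by apply: (sorted_filter (@higher_trans m)); apply: (column_sorted m_gt2 wJ).
have hS z : z \in S -> height (w x) < height z < height (bar (w y)).
  rewrite memS => /andP[zx /eqP lz].
  have zb : lw (z.1, false) = if z.2 then -1 else 1 by rewrite (entry_abs _ lw_odd) lz.
  have zq : z.1 != q.
    apply/eqP => e; move: zb; rewrite e -/(a q) aY ly0 oppr0 !if_same.
    by case: z.2.
  have zp : z.1 != p.
    apply/eqP => e; move: zb; rewrite e -/(a p) aX lx1 x2 => zb.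
    by case/eqP: zx; rewrite Xe -e; case: z zb {lz e zq} => s [].
  have b1 := btw1 z.1; have b2 := btw2 z.1; rewrite zb in b1 b2.
  have zm : (z.1 <= m)%N := ltn_ord z.1.
  have pm : (p <= m)%N := ltn_ord p.
  have qm : (q <= m)%N := ltn_ord q.
  have npq : (p : nat) <> q by apply/eqP; exact: neXY.
  rewrite Xe Ye /height /=.
  move: zp zq; rewrite -!val_eqE /= => zp zq.
  have {}b1 : (p < z.1 < q)%N -> z.2 by move=> /b1; case: z.2.
  have {}b2 : (q < z.1 < p)%N -> ~~ z.2 by move=> /b2; case: z.2.
  move: min0 b1 b2 zm pm qm npq zp zq.
  move: (nat_of_ord p) (nat_of_ord q) (nat_of_ord z.1) => P Q Z.
  case: z.2 => /=; clear => min0 b1 b2 zm pm qm npq zp zq.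
    have {}b2 : (Q < Z < P)%N -> False by move/b2.
    lia.
  have {}b1 : (P < Z < Q)%N -> False by move/b1.
  lia.
exists S; split; [apply: (column_eq m_gt2 wJ) | apply: (column_eq m_gt2 vJ)].
- by apply: sorted_higher_rcons => // z /hS /andP[].
- move=> z; rewrite mem_rcons inE memS; have [->|_] := eqVneq z (w x) => //.
  by rewrite lwx lx1.
- by apply: sorted_higher_cons => // z /hS /andP[].
move=> z; rewrite inE memS lvE lx1 ly0 addr0 mul1r /pairing.
have [nxy nyx nxby nybx] := abs_neqE neXY.
have [->|zx] := eqVneq z (w x).
  by rewrite nxy nxby eq_bar_self lwx lx1.
have [->|zby] := eqVneq z (bar (w y)).
  by rewrite bar_eq nyx [_ == w y]eq_sym eq_bar_self lw_odd lwy ly0.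
have [->|zy] := eqVneq z (w y).
  by rewrite nybx lwy ly0.
have [->|zbx] := eqVneq z (bar (w x)).
  by rewrite lw_odd lwx lx1.
by rewrite /= subr0.
Qed.

Lemma chain_letter t : chain i t = letter m.+1 t.+1.
Proof. by rewrite /chain ltn_eqF. Qed.

(** Free absolute values thus come from the zeros of [w lambda] and from the last letter of the
    column of [w]. *)
Lemma mem_prefix_abs (t : 'I_m.+1) :
  (t.+1 \in [seq absl (w (letter m.+1 u)) | u <- iota 1 i]) =
  (t != (w (chain i i)).1) && (lw (t, false) != 0).
Proof.
have im1 : (i <= m)%N := ltn_ord i.
apply/mapP/andP => [[u]|[ti lt0]].
  rewrite mem_iota => /andP[u0 ui] /= [] /val_inj tu.
  have u0' : u = u.-1.+1 by rewrite prednK.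
  have uk : (u.-1 < i)%N by rewrite -ltnS prednK // -add1n.
  rewrite u0' -chain_letter in tu.
  have um : (u.-1 <= m)%N := leq_trans (ltnW uk) im1.
  split; first by rewrite tu abs_signed // -val_eqE /= !chain_abs // ltn_eqF.
  rewrite tu (entry_abs _ lw_odd) permK weight_chain ?kE ?(ltnW uk) //;
    first by case: ifP.
  exact: ltnW.
have [c cw] : exists c : bool, (t, c) \in column i w.
  case: (int3P (lw_bound (t, false))) => lt; first by rewrite lt in lt0.
    by exists false; rewrite (mem_column m_gt2) lt.
  by exists true; rewrite (mem_column m_gt2) -[(t, true)]/(@bar m.+1 (t,
    false)) lw_odd lt.
case/mapP: cw => u; rewrite mem_iota add0n kE /= ltnS => ui e.
exists u.+1; last by rewrite /absl -chain_letter -e.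
rewrite mem_iota /= add1n ltnS ltn_neqAle ui andbT.
by apply: contra ti => /eqP ui1; rewrite -[X in chain _ X]ui1 -e.
Qed.

(** Positions [p] and [q] are free, one of them is the first position, and all positions strictly
    between carry letters of [S]; so [p] and [q] yield the two smallest free values. *)
Lemma move_forward : move_spec ->
  [/\ a_ i.+1 w 1 = 1%N,
      [set w (bar (letter m.+1 i.+1)); v L1] = [set L1; letter m.+1 (a_ i.+1 w 2)]
    & forall u, (2 <= u <= i.+1)%N -> v (letter m.+1 u) = w (letter m.+1 (u - 1))].
Proof.
move=> spec; have [S [cw cv]] := move_columns spec.
case: spec => x2 y2 min0 btw1 btw2.
have Si : size S = i by move: (size_column i w); rewrite cw size_rcons kE => -[].
have nw s : (s <= i)%N -> w (letter m.+1 s.+1) = nth L1 (rcons S (w x)) s.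
  by move=> si; rewrite -chain_letter -cw nth_column // kE.
have nv s : (s <= i)%N -> v (letter m.+1 s.+1) = nth L1 (bar (w y) :: S) s.
  by move=> si; rewrite -chain_letter -cv nth_column // kE.
have wi : w (chain i i) = w x by rewrite chain_letter nw // nth_rcons Si ltnn eqxx.
have Xe : bar (w x) = (p, false) by case: (w x) x2 => s [].
have Ye : bar (w y) = (q, false) by case: (w y) y2 => s [].
have npq : (p : nat) <> q by apply/eqP; exact: neXY.
have pm : (p <= m)%N := ltn_ord p.
have qm : (q <= m)%N := ltn_ord q.
pose M := maxn p q.
have memE (t : 'I_m.+1) := mem_prefix_abs t; rewrite wi in memE.
pose P s := s \notin [seq absl (w (letter m.+1 u)) | u <- iota 1 i].
have P1 : P p.+1 by rewrite /P memE eqxx.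
have P2 : P q.+1 by rewrite /P memE -/(a q) aY ly0 oppr0 if_same eqxx andbF.
have PM : P 1%N /\ P M.+1.
  by move: P1 P2 min0; rewrite /M; case: ltngtP => // _ P1 P2 e; rewrite e in P1 P2 *.
have Mlt : (0 < M < m.+1)%N by rewrite /M; move: min0 npq pm qm; clear; lia.
have btw r : (0 < r < M)%N -> ~~ P r.+1.
  move=> /andP[r0 rM]; have rm : (r < m.+1)%N by case/andP: Mlt => _; apply: ltn_trans.
  rewrite /P negbK (memE (Ordinal rm)).
  have [pq1|pq1|e] := ltngtP p q; last by case: npq.
    have p0 : p = 0%N :> nat by move: min0 pq1; clear; lia.
    have rq : (r < q)%N by move: rM pq1; rewrite /M; clear; lia.
    by rewrite -val_eqE /= p0 -lt0n r0 (btw1 (Ordinal rm)) //= p0 r0.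
  have q0 : q = 0%N :> nat by move: min0 pq1; clear; lia.
  have rp : (r < p)%N by move: rM pq1; rewrite /M; clear; lia.
  by rewrite -val_eqE /= ltn_eqF // (btw2 (Ordinal rm)) //= q0 r0.
have [a1 a2] := filter_iota2 Mlt PM.1 PM.2 btw.
split=> //.
  rewrite /a_ /free_abs /= a2 w_signed nw // nth_rcons Si ltnn eqxx nv //= Xe Ye.
  have letE (t : 'I_m.+1) : (t, false) = letter m.+1 t.+1 by rewrite /letter ord1_eta.
  rewrite !letE /M; have [pq1|pq1|e] := ltngtP p q; last by case: npq.
    by have -> : p = 0%N :> nat by move: min0 pq1; clear; lia.
  by rewrite setUC; have -> : q = 0%N :> nat by move: min0 pq1; clear; lia.
move=> u /andP[u2 ui]; case: u u2 ui => [|[|u]] // _; rewrite ltnS => ui.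
rewrite nv // subn1 /= nw; last exact: ltnW.
by rewrite nth_rcons Si ui.
Qed.

(** The columns are [S] followed by [A], and [B] followed by [S]. As [w x] occurs only in the first
    and [bar (w y)] only in the second, they are [A] and [B]; sortedness then gives the signs
    between. *)
Lemma move_backward :
  a_ i.+1 w 1 = 1%N ->
  [set w (bar (letter m.+1 i.+1)); v L1] = [set L1; letter m.+1 (a_ i.+1 w 2)] ->
  (forall u, (2 <= u <= i.+1)%N -> v (letter m.+1 u) = w (letter m.+1 (u - 1))) ->
  move_spec.
Proof.
move=> a1 eset vw.
pose P s := s \notin [seq absl (w (letter m.+1 u)) | u <- iota 1 i].
have P1 : P 1%N.
  have : (a_ i.+1 w 1) \in free_abs i.+1 w.
    apply: mem_nth; rewrite lt0n; apply/eqP => s0.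
    by move: a1; rewrite /a_ nth_default ?s0.
  by rewrite a1 mem_filter => /andP[].
pose A := w (chain i i); pose B := v (chain i 0).
pose S := [seq w (chain i s) | s <- iota 0 i].
have cw : column i w = rcons S A.
  by rewrite /column kE -(addn1 i) iotaD map_cat cats1.
have cv : column i v = B :: S.
  rewrite /column kE /= -[1%N]addn0 iotaDl -map_comp; congr (_ :: _);
    apply/eq_in_map => s.
  rewrite mem_iota add0n => /andP[_ si] /=.
  by rewrite !chain_letter add1n vw ?subn1.
have Xw : w x \in column i w by rewrite (mem_column m_gt2) lwx lx1.
have pXX : pairing (w x) (w y) (w x) = 1.
  by have [nxy _ nxby _] := abs_neqE neXY; rewrite /pairing eqxx nxy nxby eq_bar_self.
have pYY : pairing (w x) (w y) (bar (w y)) = -1.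
  have [_ nyx _ nybx] := abs_neqE neXY.
  by rewrite /pairing eqxx bar_eq nyx -!eq_bar nybx eq_bar_self.
have Xv : w x \notin column i v.
  by rewrite (mem_column m_gt2) lvE pXX lwx lx1 ly0.
have Yv : bar (w y) \in column i v.
  by rewrite (mem_column m_gt2) lvE pYY lw_odd lwy lx1 ly0.
have Yw : bar (w y) \notin column i w.
  by rewrite (mem_column m_gt2) lw_odd lwy ly0.
have AX : w x = A.
  move: Xw Xv; rewrite cw cv mem_rcons !inE negb_or => /orP[/eqP //|->].
  by rewrite andbF.
have BY : bar (w y) = B.
  move: Yv Yw; rewrite cw cv mem_rcons !inE negb_or => /orP[/eqP //|->].
  by rewrite andbF.
have pm : (p <= m)%N := ltn_ord p.
have qm : (q <= m)%N := ltn_ord q.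
have memE (t : 'I_m.+1) := mem_prefix_abs t; rewrite -/A -AX in memE.
have Pp : P p.+1 by rewrite /P memE eqxx.
have Pq : P q.+1 by rewrite /P memE -/(a q) aY ly0 oppr0 if_same eqxx andbF.
have npq : (p : nat) <> q by apply/eqP; exact: neXY.
(* [p] and [q] are distinct free positions, so one is positive; the least positive free position [M]
   gives [a_ 2 = M.+1]. *)
have exM : exists M, (0 < M)%N && P M.+1.
  have [p0|p0] := posnP p; last by exists p; rewrite p0.
  by exists q; rewrite Pq andbT lt0n; apply/eqP => q0; case: npq; rewrite p0 q0.
case: (ex_minnP exM) => M /andP[M0 PM] Mmin.
have Mm : (M <= m)%N.
  have [p0|p0] := posnP p; last by apply: leq_trans pm; apply: Mmin; rewrite p0.
  apply: leq_trans qm; apply: Mmin.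
  by rewrite Pq andbT lt0n; apply/eqP => q0; case: npq; rewrite p0 q0.
have btw r : (0 < r < M)%N -> ~~ P r.+1.
  move=> /andP[r0 rM]; apply/negP => Pr.
  by have := Mmin r; rewrite r0 Pr leqNgt rM => /(_ isT).
have Mlt : (0 < M < m.+1)%N by rewrite M0 ltnS.
have [_ a2] := filter_iota2 Mlt P1 PM btw.
move: eset; rewrite /a_ /free_abs /= a2 w_signed -!chain_letter -/A -/B -AX -BY => eset.
have inS z : (z == bar (w x)) || (z == bar (w y)) ->
  ~~ z.2 /\ (z.1 = 0%N :> nat \/ z.1 = M :> nat).
  have := in_set2 z (bar (w x)) (bar (w y));
    rewrite eset in_set2 !chain_letter !eq_letter // => <-.
  by case/orP=> /andP[/eqP -> ->]; split; auto.
have [X2 X1] := inS (bar (w x)) (ltac:(by rewrite eqxx)).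
have [Y2 Y1] := inS (bar (w y)) (ltac:(by rewrite eqxx orbT)).
rewrite /= negbK in X2; rewrite /= negbK in Y2.
have {}X1 : nat_of_ord p = 0%N \/ nat_of_ord p = M := X1.
have {}Y1 : nat_of_ord q = 0%N \/ nat_of_ord q = M := Y1.
have Xe : w x = (p, true) by case: (w x) X2 => s [].
have Ye : bar (w y) = (q, false) by case: (w y) Y2 => s [].
have colS (r : 'I_m.+1) : (0 < r < M)%N ->
  exists c : bool, [/\ (r, c) \in S & lw (r, false) = if c then -1 else 1].
  move=> /btw; rewrite /P negbK => /mapP[u];
    rewrite mem_iota => /andP[u0 ui] [] /val_inj e.
  have uk : (u.-1 < i)%N by rewrite -ltnS prednK // -add1n.
  exists (w (letter m.+1 u)).2; split.
    have -> : (r, (w (letter m.+1 u)).2) = w (chain i u.-1).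
      by rewrite chain_letter (prednK u0) e -surjective_pairing.
    by apply: (map_f (fun s => w (chain i s))); rewrite mem_iota.
  rewrite e (entry_abs _ lw_odd) permK -(prednK u0) -chain_letter weight_chain // kE.
  exact: ltnW.
have sw := column_sorted m_gt2 wJ; have sv := column_sorted m_gt2 vJ.
rewrite cw in sw; rewrite cv in sv.
split=> //; first by move: X1 Y1 npq; clear; lia.
  move=> r /andP[pr rq]; have [|c [cS ->]] := colS r.
    by move: X1 Y1 npq pr rq; clear; lia.
  (* An unbarred letter at a position before [q] would be higher than [B], the first letter of the
     column of [v]. *)
  case: c cS => // cS.
  move: sv; rewrite /= (path_sortedE (@higher_trans m)) => /andP[/allP/(_ _ cS)].
  by rewrite -BY Ye /higher /= height_lt /= ltnNge (ltnW rq).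
move=> r /andP[qr rp]; have [|c [cS ->]] := colS r.
  by move: X1 Y1 npq qr rp; clear; lia.
(* A barred letter at a position before [p] would be lower than [A], the last letter of the column
   of [w]. *)
case: c cS => // cS.
move: sw; rewrite -rev_sorted rev_rcons /= path_sortedE.
  move=> /andP[/allP/(_ (r, true))]; rewrite mem_rev => /(_ cS).
  by rewrite -AX Xe /higher /= height_lt /= ltnNge (ltnW rp).
by move=> z1 z2 z3 /= h1 h2; apply: lt_trans h1 h2.
Qed.

(** The letter [x] is read off at the end of the column. If [y] were not [\bar L] with [L] the
    letter after [x], minimality of [w] would put [w L] at a zero position strictly between [p] and
    [q], where all entries are -1. *)
Lemma move_root : move_spec -> x = letter m.+1 i.+1 /\ y = bar (letter m.+1 i.+2).
Proof.
move=> spec; have [S [cw cv]] := move_columns spec.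
case: spec => x2 y2 min0 btw1 btw2.
have Si : size S = i by move: (size_column i w); rewrite cw size_rcons kE => -[].
have wi : w (chain i i) = w x.
  by rewrite -(nth_column w L1 (_ : (i < k)%N)) ?kE // cw nth_rcons Si ltnn eqxx.
have Ye : w y = (q, true) by case: (w y) y2 => s [].
split; first by rewrite -chain_letter; apply: (@perm_inj _ w).
pose L := letter m.+1 i.+2.
have LE : L.1 = i.+1 :> nat by rewrite /= idxK //=; move: im; clear; lia.
have top (z : D) : (i.+1 < z.1)%N -> height (w z) < height (w L).
  move=> iz; have neL : L.1 != (bar z).1 by apply/eqP => e; move: iz;
    rewrite -[z.1]/((bar z).1) -e LE ltnn.
  have := min_reps_gt0 m_gt0 wJ neL.
  rewrite w_signed !height_odd weight_odd !weight_eq0 ?LE // ?(ltnW iz) // !subr_gt0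
    subrr.
  apply => //; rewrite /height LE /=.
  by have := ltn_ord z.1; case: z.2; move: iz im; rewrite /=; clear; lia.
(* [w L] is higher than both [w n] and [w (\bar n)], whose heights are opposite. *)
have hL : 0 < height (w L).
  have lastE : (letter m.+1 m.+1).1 = m :> nat by rewrite /= idxK //; lia.
  have h1 := top (letter m.+1 m.+1); have h2 := top (bar (letter m.+1 m.+1)).
  rewrite w_signed height_odd !bar1 !lastE in h1 h2.
  by have := h1 im; have := h2 im; clear; lia.
have qm : (q <= m)%N := ltn_ord q.
have [yi|yi] := eqVneq (y.1 : nat) i.+1.
  apply/eqP; have : y.1 == L.1 by rewrite -val_eqE /= yi LE.
  rewrite eq_abs => /orP[/eqP yL|//].
  by move: hL; rewrite -yL Ye /height /=; clear; lia.
have iy1 : (i.+1 < y.1)%N by rewrite ltn_neqAle eq_sym yi iy.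
have L2f : (w L).2 = false.
  by move: hL; rewrite /height; case: (w L).2 => //; clear; lia.
have wLE : w L = ((w L).1, false) by rewrite -L2f -surjective_pairing.
have rq : ((w L).1 < q)%N.
  by have := top (bar y) iy1; rewrite w_signed Ye wLE height_lt.
have lwL : lw ((w L).1, false) = 0.
  by rewrite (entry_abs _ lw_odd) L2f permK weight_eq0 ?LE.
have rp : (w L).1 != p.
  apply/eqP => e; move: lwL; rewrite e -/(a p) aX lx1; by case: ifP.
have := btw1 (w L).1; rewrite lwL rq andbT => /(_ _)/wrap[]//.
by move: rp min0 rq; rewrite -val_eqE /=; clear; lia.
Qed.

End Move.

End Edge.

(** * A common form of the three sign-changing conditions, and the coroot expansion *)

Section Proposition.
Variables (R : realFieldType) (m : nat) (m_gt2 : (2 < m)%N) (i : 'I_m.+1).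
Local Notation D := (Dn m.+1).
Local Notation l := (weight (m := m) i).
Local Notation J := [set~ i].
Local Notation k := (chain_size i).
Local Notation L1 := (letter m.+1 1).
Local Notation L2 := (letter m.+1 2).

Let m_gt0 : (0 < m)%N. Proof. exact: ltn_trans m_gt2. Qed.

Lemma pairingC (x y z : D) : pairing x y z = pairing y x z.
Proof. by rewrite /pairing addrAC [(z == x)%:Z + _]addrC. Qed.

Variables (w v : {perm D}).
Hypotheses (wJ : w \in min_reps R (n := m.+1) J) (vJ : v \in min_reps R (n := m.+1) J).

Definition reflected (x y : D) := forall z,
  l (v^-1%g z) = l (w^-1%g z) - (l x + l y) * pairing (w x) (w y) z.

(** The common core of [qD2], [qD3] and [qD4], written along [chain] so that one argument serves all
    three. *)
Definition flip_spec : Prop :=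
  [/\ (1 < k)%N, w (chain i k.-1) = bar L1, w (chain i k.-2) = bar L2,
      v (chain i 0) = L1 & v (chain i 1) = L2].

(** The root does not order its two letters, so both ways of matching [w x], [w y] with [\bar 2],
    [\bar 1] are covered, by exchanging [x] and [y]. *)
Lemma flip_edge (x y : D) : x.1 != y.1 -> reflected x y -> l x = 1 -> l y = 1 ->
  [/\ edge_eq (n := m.+1) J true w (eps R x + eps R y) v <-> flip_spec,
      flip_spec -> forall s, (1 < s < k)%N -> v (chain i s) = w (chain i (s - 2))
    & flip_spec -> eps R x + eps R y = eps R (chain i k.-2) + eps R (chain i k.-1)].
Proof.
move=> ne xy lx ly.
have yx : reflected y x by move=> z; rewrite xy pairingC [l x + _]addrC.
have ne' : y.1 != x.1 by rewrite eq_sym.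
have [sw _] := (weylDE w).1 (min_reps_weylD wJ).
have lxy : l x + l y = 2 by rewrite lx ly.
have specP : flip_spec ->
  (w x = bar L2 /\ w y = bar L1) \/ (w y = bar L2 /\ w x = bar L1).
  by case=> k1 w1 w2 v1 v2; apply: (flip_converse m_gt2 vJ xy).
have exP : (w x = bar L2 /\ w y = bar L1) \/ (w y = bar L2 /\ w x = bar L1) ->
  [/\ flip_spec, forall s, (1 < s < k)%N -> v (chain i s) = w (chain i (s - 2))
    & eps R x + eps R y = eps R (chain i k.-2) + eps R (chain i k.-1)].
  case=> -[wx wy].
    have [k1 [w1 w2] [v1 v2] vs [-> ->]] := flip_conditions m_gt2 ne wJ vJ xy lx ly
      wx wy.
    by split.
  have [k1 [w1 w2] [v1 v2] vs [-> ->]] := flip_conditions m_gt2 ne' wJ vJ yx ly lx wx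
    wy.
  by split=> //; rewrite addrC.
split=> [|/specP/exP[]//|/specP/exP[]//].
rewrite (flip_edgeE m_gt2 ne wJ vJ xy lx ly); split=> [[x2 y2 xlt ylt]|/specP].
  have nXY : (w x).1 != (w y).1 by rewrite abs_signed.
  have lt2 (a b : nat) : (a < 2)%N -> (b < 2)%N -> a != b ->
    (a == 1)%N && (b == 0)%N || (b == 1)%N && (a == 0)%N.
    by case: a b => [|[|a]] [|[|b]].
  have := lt2 _ _ xlt ylt nXY => /orP[]/andP[e1 e2];
    apply: (let: And3 h _ _ := exP _ in h); [left|right];
    split; apply/eqP; rewrite eq_bar_letter // ?e1 ?e2 ?x2 ?y2 //.
have b1 : (bar L1).1 = 0%N :> nat by rewrite /= idxK.
have b2 : (bar L2).1 = 1%N :> nat by rewrite /= idxK //; move: m_gt2; clear; lia.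
by case=> -[-> ->]; rewrite b1 b2.
Qed.

Lemma simple_coroot (j : nat) : (0 < j <= m.+1)%N ->
  coroot (n := m.+1) (alpha R m.+1 j) = alpha R m.+1 j.
Proof.
by case: j => // j jm; rewrite alphaE // coroot_root // simple_abs.
Qed.

Lemma alpha_lt (j : nat) : (j <= m)%N ->
  alpha R m.+1 j = e R (n := m.+1) j - e R (n := m.+1) j.+1.
Proof. by rewrite /alpha ltnS => ->. Qed.

Lemma alpha_last : alpha R m.+1 m.+1 = e R (n := m.+1) m + e R (n := m.+1) m.+1.
Proof. by rewrite /alpha ltnn. Qed.

Lemma coroot_sum (j : nat) : (1 < j <= m)%N ->
  e R (n := m.+1) (j - 1) + e R (n := m.+1) j =
  coroot (n := m.+1) (alpha R m.+1 (j - 1)) + \sum_(j <= s < m.+1 - 1) 2 *: coroot (n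
    := m.+1) (alpha R m.+1 s)
    + coroot (n := m.+1) (alpha R m.+1 (m.+1 - 1)) + coroot (n := m.+1) (alpha R m.+1
      m.+1).
Proof.
case/andP => j1 jm; rewrite subn1 /=.
(* Writing [2 alpha_s] as the increment of [-2 e_s] makes the sum telescope. *)
rewrite (eq_big_nat _ _ (F2 := fun s =>
  (- 2 *: e R (n := m.+1) s.+1) - (- 2 *: e R (n := m.+1) s))) => [|s /andP[js sm]].
  rewrite subn1 /= telescope_sumr // !simple_coroot ?alpha_last ?alpha_lt //;
    try by move: j1 jm; clear; lia.
  rewrite (prednK (ltnW j1)).
  move: (e R j.-1) (e R j) (e R m) (e R m.+1) => a b c d.
  by apply/rowP => s; rewrite !mxE; ring.
rewrite subn1 /= in sm; rewrite simple_coroot ?alpha_lt ?(ltnW sm) //;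
  last by move: j1 js sm; clear; lia.
by rewrite !scaleNr opprK scalerBr addrC.
Qed.

Definition flip_tail : Prop :=
  forall s, (1 < s < k)%N -> v (chain i s) = w (chain i (s - 2)).

Let sw : signed w. Proof. by have [] := (weylDE w).1 (min_reps_weylD wJ). Qed.
Let sv : signed v. Proof. by have [] := (weylDE v).1 (min_reps_weylD vJ). Qed.
Let im : (i <= m)%N. Proof. exact: (ltn_ord i). Qed.

Let barE (x y : D) : bar x = y -> x = bar y.
Proof. by move=> <-; rewrite barK. Qed.

Lemma qD2E gamma : (i.+1 < m)%N -> qD2 (R := R) (n := m.+1) i.+1 w gamma v <->
  [/\ coroot_coef (n := m.+1) i.+1 (coroot gamma) = 2, flip_spec & flip_tail].
Proof.
move=> i1m; have kE : k = i.+1 by rewrite /chain_size i1m.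
have chE s : chain i s = letter m.+1 s.+1 by rewrite /chain ltn_eqF.
rewrite /qD2 /flip_spec /flip_tail kE /= !chE !sw subn1 /=.
split=> [[[/andP[i1 _] c2] [v1 w1] [v2 w2] vt]|[c2 [i1 w1 w2 v1 v2] vt]].
  split=> //.
    by rewrite v1 v2 (prednK (i1 : (0 < i)%N)) (barE w1) (barE w2) !barK; split.
  move=> s s1; rewrite !chE vt; last by move: s1; clear; lia.
  by congr (w (letter _ _)); move: s1; clear; lia.
rewrite (prednK (i1 : (0 < i)%N)) in w2; rewrite v1 v2 w1 w2 !barK; split=> //.
  by split=> //; move: i1m i1; clear; lia.
case=> [|[|[|u]]] // u1; have := vt u.+2; rewrite !chE => ->; last by move: u1;
  clear; lia.
by congr (w (letter _ _)); move: u1; clear; lia.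
Qed.

(** The chain ends with [\bar n] here: the condition on [w n] is the last flip condition barred, and
    the one on [v n] is the last equation of [flip_tail] barred. *)
Lemma qD3E gamma : i.+1 = m -> qD3 (R := R) (n := m.+1) i.+1 w gamma v <->
  [/\ coroot_coef (n := m.+1) (m.+1 - 1) (coroot gamma) = 1, flip_spec & flip_tail].
Proof.
move=> i1m; have kE : k = m.+1 by rewrite /chain_size i1m ltnn.
have chm : chain i m = bar (letter m.+1 m.+1) by rewrite /chain i1m !eqxx.
have chE s : s != m -> chain i s = letter m.+1 s.+1 by rewrite /chain => /negPf ->;
  rewrite andbF.
have m1 : (m.-1.+1 = m)%N by rewrite prednK.
have m1m : m.-1 != m by rewrite neq_ltn -[in X in X || _]m1 ltnSn.
have n0 : 0%N != m by rewrite neq_ltn m_gt0.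
have n1 : 1%N != m by rewrite neq_ltn (ltn_trans _ m_gt2).
rewrite /qD3 /flip_spec /flip_tail kE /= chm !chE // !sw m1 !subn1 /=.
split=> [[[_ c1] [v1 w1] [v2 w2] vt vn]|[c1 [k1 w1 w2 v1 v2] vt]].
  split=> //; first by rewrite v1 v2 w1 (barE w2) !barK; split.
  move=> s s1; have [->|sm] := eqVneq s m.
    rewrite chm sv vn barK chE; last by move: m_gt2; clear; lia.
    by congr (w (letter _ _)); move: m_gt2; clear; lia.
  rewrite !chE // ?vt; try by move: s1 sm; clear; lia.
  by congr (w (letter _ _)); move: s1 sm; clear; lia.
rewrite v1 v2 w2 -[w (letter _ m.+1)]barK w1 !barK; split=> //.
  case=> [|[|[|u]]] // u1; have := vt u.+2; rewrite !chE; try by move: u1; clear; lia.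
  move=> ->; last by move: u1; clear; lia.
  by congr (w (letter _ _)); move: u1; clear; lia.
have := vt m; rewrite chm sv chE; last by move: m_gt2; clear; lia.
rewrite ltnSn andbT => /(_ (ltn_trans _ m_gt2)) -/(_ isT) /barE ->;
  congr (bar (w (letter _ _))).
by move: m_gt2; clear; lia.
Qed.

Lemma qD4E gamma : i = m :> nat -> qD4 (R := R) (n := m.+1) i.+1 w gamma v <->
  [/\ coroot_coef (n := m.+1) m.+1 (coroot gamma) = 1, flip_spec & flip_tail].
Proof.
move=> eim; have kE : k = m.+1 by rewrite /chain_size eim ltnNge leqnSn.
have chE s : chain i s = letter m.+1 s.+1 by rewrite /chain eim [_ == m]gtn_eqF.
have m1 : (m.-1.+1 = m)%N by rewrite prednK.
rewrite /qD4 /flip_spec /flip_tail kE /= !chE m1 subn1 /= eim.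
split=> [[[_ c1] [v1 w1] [v2 w2] vt]|[c1 [k1 w1 w2 v1 v2] vt]].
  split=> //; first by rewrite v1 v2 w1 w2 (barE w1) (barE w2); split.
  move=> s s1; rewrite !chE vt; last by move: s1; clear; lia.
  by congr (w (letter _ _)); move: s1; clear; lia.
rewrite v1 v2 w1 w2 !barK; split=> //.
case=> [|[|[|u]]] // u1; have := vt u.+2; rewrite !chE => ->; last by move: u1;
  clear; lia.
by congr (w (letter _ _)); move: u1; clear; lia.
Qed.

End Proposition.

(** * Separation of the cases by the node and by the values of [lambda] *)

Section Assembly.
Variables (R : realFieldType) (m : nat) (m_gt2 : (2 < m)%N) (i : 'I_m.+1).
Local Notation D := (Dn m.+1).
Local Notation l := (weight (m := m) i).
Local Notation J := [set~ i].

Let m_gt0 : (0 < m)%N. Proof. exact: ltn_trans m_gt2. Qed.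

(** Two numbers among -1, 0, 1 with positive sum are, up to exchange, 1 and 1 or 1 and 0. *)
Lemma root_letters (gamma : 'rV[R]_m.+1) :
  gamma \in pos_roots R m.+1 -> gamma \notin pos_rootsJ R (n := m.+1) J ->
  exists x y : D, [/\ gamma = eps R x + eps R y, x.1 != y.1,
    l x = 1 & l y = 1 \/ l y = 0].
Proof.
move=> gpos gJ; have [x [y [gE ne h]]] := in_pos_roots m_gt0 gpos.
have : 0 < l x + l y.
  rewrite -(weight_neq0E m_gt0) // h /=; apply: contra gJ => /eqP l0.
  by rewrite pos_rootsJE mem_filter gpos gE root_coef_root // l0 mulr0 eqxx.
case: (int3P (weight_bound i x)) => lx; case: (int3P (weight_bound i y)) => ly;
  rewrite lx ly // => _.
- by exists y, x; split; auto; rewrite 1?addrC 1?eq_sym.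
- by exists x, y; split; auto.
by exists x, y; split; auto.
Qed.

(** The reflection is its own inverse, conjugation by [w] turns its root into [w gamma], and
    [floorJ] does not change the weight vector. *)
Lemma floorJ_reflected (w : {perm D}) (x y : D) : w \in min_reps R (n := m.+1) J ->
  x.1 != y.1 ->
  let v := floorJ R (n := m.+1) J (wcomp w (refl (n := m.+1) (eps R x + eps R y))) in
  v \in min_reps R (n := m.+1) J /\ reflected i w v x y.
Proof.
move=> wJ ne v; have wW := min_reps_weylD wJ; have [sw _] := (weylDE w).1 wW.
have wrW : wcomp w (refl (n := m.+1) (eps R x + eps R y)) \in weylD m.+1.
  by rewrite reflE // (groupM (G := Group (weylD_group m))) //; apply: srefl_weylD.
have [vJ lv] := floorJ_spec R m_gt0 i wrW; split=> // z.
rewrite lv reflE // /wcomp invMg permM.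
have -> : (srefl x y)^-1%g = srefl x y.
  by apply/permP => t; apply: (@perm_inj _ (srefl x y)); rewrite permKV srefl_invol.
rewrite (oddf_srefl _ (@weight_odd m i)) // mulrzz; congr (_ - _ * _).
have E t : (w^-1%g z == t) = (z == w t) by rewrite -(inj_eq (@perm_inj _ w)) permKV.
by rewrite /pairing !E !sw.
Qed.

(** The value [l y = 0] occurs only for nodes up to n - 2 and leads to [qD1]. The value [l y = 1]
    leads to [qD2], [qD3] or [qD4] according to the node. The coefficient [(l x + l y) / weight_den]
    separates [qD1] from [qD2]. *)
Lemma quantum_edge_cases (w : {perm D}) (gamma : 'rV[R]_m.+1) :
  let v := floorJ R (n := m.+1) J (wcomp w (refl (n := m.+1) gamma)) in
  w \in min_reps R (n := m.+1) J ->
  gamma \in pos_roots R m.+1 -> gamma \notin pos_rootsJ R (n := m.+1) J ->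
  [/\ quantum_edge (n := m.+1) J w gamma v <->
        [\/ qD1 (n := m.+1) i.+1 w gamma v, qD2 (n := m.+1) i.+1 w gamma v,
            qD3 (n := m.+1) i.+1 w gamma v | qD4 (n := m.+1) i.+1 w gamma v],
      qD1 (n := m.+1) i.+1 w gamma v ->
        gamma = e R (n := m.+1) i.+1 - e R (n := m.+1) i.+2,
      qD2 (n := m.+1) i.+1 w gamma v ->
        gamma = e R (n := m.+1) (i.+1 - 1) + e R (n := m.+1) i.+1,
      qD3 (n := m.+1) i.+1 w gamma v ->
        gamma = e R (n := m.+1) (m.+1 - 1) - e R (n := m.+1) m.+1
    & qD4 (n := m.+1) i.+1 w gamma v ->
        gamma = e R (n := m.+1) (m.+1 - 1) + e R (n := m.+1) m.+1].
Proof.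
move=> v wJ gpos gJ; have [x [y [gE ne lx ly]]] := root_letters gpos gJ.
have [vJ xy] : v \in min_reps R (n := m.+1) J /\ reflected i w v x y.
  by rewrite /v gE; apply: floorJ_reflected.
have qE : quantum_edge (n := m.+1) J w gamma v <-> edge_eq (n := m.+1) J true w gamma v.
  by split=> [[]|E] //; split=> //; split=> //; exists true.
have cE : coroot (n := m.+1) gamma = gamma by rewrite gE coroot_root.
have cf : coroot_coef (n := m.+1) i.+1 gamma = (weight_den m i)%:R^-1 * (l x + l y)%:~R.
  by rewrite coroot_coefE // ord1_eta // gE root_coef_root.
have im : (i <= m)%N := ltn_ord i.
have n12 : (1 : R) <> 2 by move/eqP; rewrite -subr_eq0 opprD addNKr oppr_eq0 oner_eq0.
have D1 : qD1 (n := m.+1) i.+1 w gamma v ->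
  (i.+1 < m)%N /\ coroot_coef (n := m.+1) i.+1 gamma = 1.
  by rewrite /qD1 cE => -[[/andP[_ ?] ?] _ _ _]; split=> //; move: m_gt2; lia.
have D2 : qD2 (n := m.+1) i.+1 w gamma v ->
  (i.+1 < m)%N /\ coroot_coef (n := m.+1) i.+1 gamma = 2.
  by rewrite /qD2 cE => -[[/andP[_ ?] ?] _ _ _]; split=> //; move: m_gt2; lia.
have D3 : qD3 (n := m.+1) i.+1 w gamma v -> i.+1 = m by case=> -[+ _] _ _ _ _;
  rewrite subn1.
have D4 : qD4 (n := m.+1) i.+1 w gamma v -> i = m :> nat by case=> -[[+] _] _ _ _.
case: ly => ly; last first.
  have [im1 _] := weight_eq0P ly.
  have cf1 : coroot_coef (n := m.+1) i.+1 gamma = 1.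
    by rewrite cf lx ly /weight_den im1 invr1 mul1r.
  have nD2 : ~ qD2 (n := m.+1) i.+1 w gamma v by case/D2 => _; rewrite cf1.
  have nD3 : ~ qD3 (n := m.+1) i.+1 w gamma v by move/D3 => i1m;
    rewrite i1m ltnn in im1.
  have nD4 : ~ qD4 (n := m.+1) i.+1 w gamma v by move/D4 => i1m;
    rewrite i1m ltnNge leqnSn in im1.
  have D1E : qD1 (n := m.+1) i.+1 w gamma v <-> move_spec i x y w.
    split=> [[_ a1 a2 vt]|spec]; first exact: (move_backward m_gt2 ne wJ vJ xy).
    have [a1 a2 vt] := move_forward m_gt2 ne wJ vJ xy lx ly spec.
    by split=> //; rewrite cE; split=> //; move: im1; clear; lia.
  split=> // [|/D1E spec]; last first.
    have [xE yE] := move_root m_gt2 ne wJ vJ xy lx ly spec.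
    by rewrite gE xE yE eps_odd.
  rewrite qE gE (move_edgeE m_gt2 ne wJ vJ xy lx ly) -gE -D1E.
  by split=> [|[]//]; first by constructor 1.
have [F1 F2 F3] := flip_edge m_gt2 wJ vJ ne xy lx ly; rewrite -gE in F1 F3.
have lxy : (l x + l y)%:~R = 2 :> R by rewrite lx ly.
rewrite lxy in cf.
have [im1|im1|im1] := ltngtP i.+1 m.
- have cf2 : coroot_coef (n := m.+1) i.+1 gamma =
  2 by rewrite cf /weight_den im1 invr1 mul1r.
  have nD1 : ~ qD1 (n := m.+1) i.+1 w gamma v by case/D1 => _; rewrite cf2 => /esym.
  have nD3 : ~ qD3 (n := m.+1) i.+1 w gamma v by move/D3 => i1m;
    rewrite i1m ltnn in im1.
  have nD4 : ~ qD4 (n := m.+1) i.+1 w gamma v by move/D4 => i1m;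
    rewrite i1m ltnNge leqnSn in im1.
  have D2' := qD2E v wJ gamma im1; rewrite cE cf2 in D2'.
  split=> // [|/D2'[_ /[dup] spec /F3 -> _]].
    rewrite qE F1; split=> [spec|[] // /D2'[]//].
    by constructor 2; apply/D2'; split=> //; apply: F2.
  case: spec => k1 _ _ _ _; move: k1.
  rewrite /chain_size im1 /= subn1 => i0.
  by rewrite /chain !(ltn_eqF im1) /= prednK.
- have eim : i = m :> nat by move: im im1; clear; lia.
  have cf2 : coroot_coef (n := m.+1) m.+1 gamma = 1.
    by move: cf; rewrite /weight_den eim ltnNge leqnSn /= => ->;
      rewrite mulVf // pnatr_eq0.
  have nD1 : ~ qD1 (n := m.+1) i.+1 w gamma v by case/D1; rewrite eim ltnNge leqnSn.
  have nD2 : ~ qD2 (n := m.+1) i.+1 w gamma v by case/D2; rewrite eim ltnNge leqnSn.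
  have nD3 : ~ qD3 (n := m.+1) i.+1 w gamma v by move/D3; rewrite eim; clear; lia.
  have D4' := qD4E m_gt2 w v gamma eim; rewrite cE cf2 in D4'.
  split=> // [|/D4'[_ /F3 -> _]].
    rewrite qE F1; split=> [spec|[] // /D4'[]//].
    by constructor 4; apply/D4'; split=> //; apply: F2.
  by rewrite /chain_size eim ltnNge leqnSn /= subn1 /= /chain eim [_ == m]gtn_eqF //=.
have cf2 : coroot_coef (n := m.+1) (m.+1 - 1) gamma = 1.
  by move: cf; rewrite /weight_den im1 ltnn subn1 /= => ->; rewrite mulVf // pnatr_eq0.
have nD1 : ~ qD1 (n := m.+1) i.+1 w gamma v by case/D1; rewrite im1 ltnn.
have nD2 : ~ qD2 (n := m.+1) i.+1 w gamma v by case/D2; rewrite im1 ltnn.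
have nD4 : ~ qD4 (n := m.+1) i.+1 w gamma v by move/D4 => e; move: im1; rewrite e;
  clear; lia.
have D3' := qD3E m_gt2 wJ vJ gamma im1; rewrite cE cf2 in D3'.
split=> // [|/D3'[_ /F3 -> _]].
  rewrite qE F1; split=> [spec|[] // /D3'[]//].
  by constructor 3; apply/D3'; split=> //; apply: F2.
rewrite /chain_size im1 ltnn subn1 /= /chain im1 !eqxx /= (prednK m_gt0) eps_odd.
by rewrite (_ : (m.-1 == m) = false) // ltn_eqF // (prednK m_gt0).
Qed.

End Assembly.

Theorem proposition4p42 (R : realFieldType) (n : nat) (hn : (4 <= n)%N)
    (i : nat) (hi : (1 <= i <= n)%N)
    (w : {perm Dn n}) (gamma : 'rV[R]_n.-1.+1) :
  let J : {set 'I_n.-1.+1} := [set~ idx n i] in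
  let v : {perm Dn n} := floorJ R J (wcomp w (refl gamma)) in
  w \in min_reps R J ->
  gamma \in pos_roots R n -> gamma \notin pos_rootsJ R J ->
  [/\ quantum_edge J w gamma v <->
        [\/ qD1 i w gamma v, qD2 i w gamma v, qD3 i w gamma v
          | qD4 i w gamma v],
      qD1 i w gamma v ->
        coroot gamma = e R i - e R i.+1
        /\ coroot gamma = coroot (alpha R n i),
      qD2 i w gamma v ->
        coroot gamma = e R (i - 1) + e R i
        /\ coroot gamma
           = coroot (alpha R n (i - 1))
             + \sum_(i <= k < n - 1) 2 *: coroot (alpha R n k)
             + coroot (alpha R n (n - 1)) + coroot (alpha R n n),
      qD3 i w gamma v ->
        coroot gamma = e R (n - 1) - e R n
        /\ coroot gamma = coroot (alpha R n (n - 1))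
    & qD4 i w gamma v ->
        coroot gamma = e R (n - 1) + e R n
        /\ coroot gamma = coroot (alpha R n n)].
Proof.
case: n hn hi w gamma => // m; rewrite ltnS => m_gt2.
case: i => // j /andP[_]; rewrite ltnS => jm w gamma.
have m_gt0 : (0 < m)%N by exact: ltn_trans m_gt2.
pose i : 'I_m.+1 := Ordinal (jm : (j < m.+1)%N).
move=> J; have JE : J = [set~ i] by rewrite /J -(ord1_eta m_gt0 i).
clearbody J; rewrite {J}JE -[j]/(nat_of_ord i) => v wJ gpos gJ.
have cE : coroot (n := m.+1) gamma = gamma.
  by have [x [y [-> ne _]]] := in_pos_roots m_gt0 gpos; rewrite coroot_root.
have [G1 G2 G3 G4 G5] := quantum_edge_cases m_gt2 wJ gpos gJ.
rewrite -/v in G1 G2 G3 G4 G5; rewrite cE.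
split=> [//|d1|d2|d3|d4].
- have i1m : (i.+1 <= m)%N.
    by case: d1 => -[/andP[_ +] _] _ _ _; move: m_gt2; clear; lia.
  have i1m' : (0 < i.+1 <= m.+1)%N by apply: leqW.
  by rewrite (simple_coroot R m_gt2 i1m') (alpha_lt R i1m) -(G2 d1).
- have i1m : (1 < i.+1 <= m)%N.
    by case: d2 => -[/andP[i1 i2] _] _ _ _; move: m_gt2 i1 i2; clear; lia.
  by rewrite -(coroot_sum R m_gt2 i1m) -(G3 d2).
- have m1 : (0 < m.+1 - 1 <= m.+1)%N by rewrite subn1 m_gt0 leqnSn.
  by rewrite (simple_coroot R m_gt2 m1) -(G4 d3) subn1 (alpha_lt R (leqnn m)) (G4 d3) subn1.
have m1 : (0 < m.+1 <= m.+1)%N by rewrite leqnn.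
by rewrite (simple_coroot R m_gt2 m1) alpha_last (G5 d4) subn1.
Qed.
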